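(* There is no curve framing algorithm defined on all of $\mathcal{B}$; that is, there is no continuous map $\sigma:\mathcal{B}\to\mathcal{M}$ with $\pi\circ\sigma=\mathrm{id}_{\mathcal{B}}$, where $\pi:\mathcal{M}\to\mathcal{B}$, $[\gamma,V]\mapsto[\gamma]$, is the forget-framing map.
   Context: Let $S^1=[0,2]/(0\sim 2)$ and let $\mathbb{S}^1\subset\mathbb{C}$ be the unit circle group. A framed path is a pair $(\gamma,V)$ of smooth maps $[0,2]\to\mathbb{R}^3$ with $\gamma$ an immersion and $V$ a unit vector field with $V\perp\gamma'$; framed paths modulo translation form a Fréchet manifold $\mathcal{O}$ ($C^\infty$ topology). A framed loop is a framed path such that $\gamma'$ and $V$ are smooth closed curves (smooth on $S^1$) and $\gamma(0)=\gamma(2)$; $\mathcal{C}\subset\mathcal{O}$ is the space of framed loops modulo translation. $\mathcal{M}=\mathcal{C}/(\mathrm{SO}(3)\times\mathbb{R}^+\times\mathbb{S}^1)$, where $\mathrm{SO}(3)$ acts by $(A\gamma,AV)$, $r\in\mathbb{R}^+$ by $(r\gamma,V)$, and $e^{i\theta}\in\mathbb{S}^1$ by the constant frame twist $(\gamma,\cos(2\theta)V+\sin(2\theta)W)$, $W=\frac{\gamma'}{\|\gamma'\|}\times V$. $\mathcal{B}=\mathrm{Imm}(S^1,\mathbb{R}^3)/\mathrm{Sim}$ is the space of smooth immersed loops modulo translations, rotations and scalings. A curve framing algorithm is a continuous section, with respect to the forget-framing map, from a subset of $\mathcal{B}$ to $\mathcal{M}$. *)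

(* Defs.v *)
From HB Require Import structures.
From mathcomp Require Import all_boot all_order all_algebra.
From mathcomp Require Import all_classical all_reals all_analysis.
From mathcomp Require Import ring lra.
Set Implicit Arguments.
Unset Strict Implicit.
Unset Printing Implicit Defensive.
Import Order.TTheory GRing.Theory Num.Theory.
Import numFieldNormedType.Exports.
Local Open Scope classical_set_scope.
Local Open Scope ring_scope.
Local Open Scope quotient_scope.

Section ClassicalQuotient.
Variables (T : choiceType) (e : T -> T -> Prop).
Hypotheses (e_refl : forall x, e x x) (e_sym : forall x y, e x y -> e y x)
  (e_trans : forall x y z, e x y -> e y z -> e x z).

Definition brel : rel T := fun x y => `[< e x y >].

Lemma brel_refl : reflexive brel.
Proof. by move=> x; apply/asboolP. Qed.

Lemma brel_sym : symmetric brel.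
Proof. by move=> x y; apply/asboolP/asboolP => /e_sym. Qed.

Lemma brel_trans : transitive brel.
Proof. by move=> y x z /asboolP xy /asboolP yz; apply/asboolP/(e_trans xy yz). Qed.

Definition equiv_of_Prop : equiv_rel T := EquivRel brel brel_refl brel_sym brel_trans.

End ClassicalQuotient.

Section EuclideanSpace.
Variable R : realType.
Local Notation E := 'cV[R]_3.

Definition dot (u v : E) : R := \sum_i u i 0 * v i 0.

(* The Euclidean norm; the library norm `|u| on 'cV[R]_3 is the sup norm. *)
Definition enorm (u : E) : R := Num.sqrt (dot u u).

(* Addition in 'I_3 is modulo 3. *)
Definition cross (u v : E) : E :=
  \col_i (u (i + 1) 0 * v (i + 2%:R) 0 - u (i + 2%:R) 0 * v (i + 1) 0).

Definition SO3 : set 'M[R]_3 := [set A | A *m A^T = 1%:M /\ \det A = 1].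

Lemma sum3 (F : 'I_3 -> R) : \sum_i F i = F 0 + F 1 + F 2%:R.
Proof.
rewrite !big_ord_recl big_ord0 addr0 addrA.
by congr (F _ + F _ + F _); apply/val_inj.
Qed.

Lemma ord3P (P : 'I_3 -> Prop) : P 0 -> P 1 -> P 2%:R -> forall i, P i.
Proof.
move=> P0 P1 P2 [[|[|[|//]]] lti].
- by rewrite (_ : Ordinal _ = 0) //; apply/val_inj.
- by rewrite (_ : Ordinal _ = 1) //; apply/val_inj.
- by rewrite (_ : Ordinal _ = 2%:R) //; apply/val_inj.
Qed.

Lemma ord3E : ((0 + 1)%R = 1%R :> 'I_3) * ((0 + 2%:R)%R = 2%:R :> 'I_3) *
  ((1 + 1)%R = 2%:R :> 'I_3) * ((1 + 2%:R)%R = 0%R :> 'I_3) *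
  ((2%:R + 1)%R = 0%R :> 'I_3) * ((2%:R + 2%:R)%R = 1%R :> 'I_3).
Proof. by do !split; apply/val_inj. Qed.

Lemma det3 (A : 'M[R]_3) : \det A =
  A 0 0 * (A 1 1 * A 2%:R 2%:R - A 1 2%:R * A 2%:R 1)
  - A 0 1 * (A 1 0 * A 2%:R 2%:R - A 1 2%:R * A 2%:R 0)
  + A 0 2%:R * (A 1 0 * A 2%:R 1 - A 1 1 * A 2%:R 0).
Proof.
pose a (i j : nat) := A (inord i) (inord j).
have Aa i j : A i j = a i j by rewrite /a !inord_val.
rewrite (expand_det_row _ 0) sum3 /cofactor.
rewrite !(expand_det_row _ 0) !big_ord_recl !big_ord0 /cofactor !det_mx11 !mxE.
rewrite !Aa /= /bump /=.
rewrite !(addn0, add0n, modnn, add1n, addn1) /=.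
ring.
Qed.

Lemma SO3_trmxM A : SO3 A -> A^T *m A = 1%:M.
Proof. by case=> AA _; rewrite mulmx1C. Qed.

Lemma SO3_1 : SO3 1%:M.
Proof. by split; rewrite ?trmx1 ?mulmx1 ?det1. Qed.

Lemma SO3_tr A : SO3 A -> SO3 A^T.
Proof. by move=> sA; split; [rewrite trmxK SO3_trmxM|case: sA; rewrite det_tr]. Qed.

Lemma SO3_M A B : SO3 A -> SO3 B -> SO3 (A *m B).
Proof.
move=> [AA dA] [BB dB]; split; last by rewrite det_mulmx dA dB mulr1.
by rewrite trmx_mul mulmxA -(mulmxA A) BB mulmx1.
Qed.

Lemma dotE u v : dot u v = (u^T *m v) 0 0.
Proof. by rewrite mxE; apply: eq_bigr => i _; rewrite mxE. Qed.

Lemma dot_SO3 A u v : SO3 A -> dot (A *m u) (A *m v) = dot u v.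
Proof.
by move=> sA; rewrite !dotE trmx_mul -mulmxA (mulmxA A^T) SO3_trmxM ?mul1mx.
Qed.

Lemma enorm_SO3 A u : SO3 A -> enorm (A *m u) = enorm u.
Proof. by move=> sA; rewrite /enorm dot_SO3. Qed.

Lemma dotZl a u v : dot (a *: u) v = a * dot u v.
Proof. by rewrite mulr_sumr; apply: eq_bigr => i _; rewrite !mxE mulrA. Qed.

Lemma dotZr a u v : dot u (a *: v) = a * dot u v.
Proof. by rewrite mulr_sumr; apply: eq_bigr => i _; rewrite !mxE mulrCA. Qed.

Lemma enormZ r u : 0 <= r -> enorm (r *: u) = r * enorm u.
Proof.
move=> r0; rewrite /enorm dotZl dotZr mulrA -expr2.
by rewrite sqrtrM ?sqr_ge0 // sqrtr_sqr ger0_norm.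
Qed.

Lemma dot_ge0 u : 0 <= dot u u.
Proof. by apply: sumr_ge0 => i _; rewrite -expr2 sqr_ge0. Qed.

Lemma dot_gt0 u : u != 0 -> 0 < dot u u.
Proof.
move=> u0; rewrite lt_neqAle dot_ge0 andbT eq_sym; apply: contra u0 => /eqP duu.
have sq0 i : true -> 0 <= u i 0 * u i 0 by rewrite -expr2 sqr_ge0.
apply/eqP/colP => i; rewrite mxE; apply/eqP; rewrite -sqrf_eq0 expr2.
exact/eqP/(psumr_eq0P sq0 duu).
Qed.

Lemma crossM A u v : SO3 A -> cross (A *m u) (A *m v) = A *m cross u v.
Proof.
move=> sA; have [_ dA] := sA.
suff <- : A^T *m cross (A *m u) (A *m v) = cross u v.
  by rewrite mulmxA; case: sA => -> _; rewrite mul1mx.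
rewrite -[RHS]scale1r -dA det3; apply/colP; apply: ord3P;
  by rewrite !mxE sum3 !mxE !ord3E !sum3; ring.
Qed.

Lemma crossZl a u v : cross (a *: u) v = a *: cross u v.
Proof. by apply/colP => i; rewrite !mxE; ring. Qed.

Lemma cross_lin u v w a b : cross u (a *: v + b *: w) = a *: cross u v + b *: cross u w.
Proof. by apply/colP => i; rewrite !mxE; ring. Qed.

Lemma cross_cross u v : dot u u = 1 -> dot v u = 0 -> cross u (cross u v) = - v.
Proof.
move=> uu vu.
suff -> : cross u (cross u v) = dot v u *: u - dot u u *: v.
  by rewrite uu vu scale0r scale1r sub0r.
rewrite /dot !sum3; apply/colP; apply: ord3P; rewrite !mxE !ord3E; ring.
Qed.
End EuclideanSpace.

Section SmoothPaths.
Variable R : realType.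
Local Notation E := 'cV[R]_3.

Definition interval02 : set R := `[0, 2]%classic.
Local Notation I := (set_type interval02).

Lemma interval02_0 : interval02 0.
Proof. by rewrite /interval02 /= in_itv /= lexx ler0n. Qed.

Lemma interval02_2 : interval02 2.
Proof. by rewrite /interval02 /= in_itv /= lexx ler0n. Qed.

Definition pt0 : I := exist _ 0 (mem_set interval02_0).
Definition pt2 : I := exist _ 2 (mem_set interval02_2).

(* I carries the subspace topology of [0, 2], so that the derivative below is
   one-sided at the two endpoints. *)
Definition diffq (f : I -> E) (t : I) : I -> E :=
  fun s => (\val s - \val t)^-1 *: (f s - f t).

Definition derivI (f : I -> E) : I -> E := fun t => lim (diffq f t @ t^').

Definition derivableI (f : I -> E) : Prop := forall t, cvg (diffq f t @ t^').

Definition smoothI (f : I -> E) : Prop := forall k, derivableI (iter k derivI f).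

(* f descends to a smooth map on S^1 = R / 2Z = [0, 2] / (0 ~ 2), i.e. it is
   the restriction to [0, 2] of a smooth 2-periodic map. *)
Definition smooth_circle (f : I -> E) : Prop := exists g : R -> E,
  [/\ forall k x, derivable (derive1n k g) x 1,
      forall x, g (x + 2) = g x &
      forall t : I, f t = g (\val t)].

Lemma diffq_cvgP f (t : I) (l : E) : diffq f t @ t^' --> l <->
  (forall e, 0 < e -> exists2 d, 0 < d & forall s : I, s != t ->
    `|\val s - \val t| < d -> `|l - diffq f t s| < e).
Proof.
split=> [/cvgrPdist_lt fl e e0|fl].
  have /nbhs_ballP[d d0 H] := fl _ e0.
  exists d => // s st sd; apply: H => //.
  by rewrite distrC in sd; exact: sd.
apply/cvgrPdist_lt => e /fl[d d0 H].
apply/nbhs_ballP; exists d => // s ts st; apply: H => //.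
by rewrite distrC.
Qed.

Lemma interval02_close (x d : R) : interval02 x -> 0 < d ->
  exists2 u, interval02 u & 0 < `|x - u| < d.
Proof.
rewrite /interval02 /= in_itv /= => /andP[x0 x2] d0.
pose m := Num.min (d / 2) 1.
have m0 : 0 < m by rewrite lt_min ltr01 divr_gt0.
have md : m < d by rewrite gt_min; apply/orP; left; lra.
have m1 : m <= 1 by rewrite ge_min lexx orbT.
clearbody m; have [x1|x1] := leP x 1.
  exists (x + m); first by rewrite in_itv /=; apply/andP; split; lra.
  by rewrite opprD addNKr normrN gtr0_norm // m0.
exists (x - m); first by rewrite in_itv /=; apply/andP; split; lra.
by rewrite opprB addrC subrK gtr0_norm // m0.
Qed.

Lemma I_dnbhs_proper (t : I) : ProperFilter t^'.
Proof.
apply: Build_ProperFilter_ex => A /nbhs_ballP[d /= d0 H].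
have [u uI ut] := interval02_close (set_mem (valP t)) d0.
exists (exist _ u (mem_set uI)); apply: H; first by case/andP: ut.
by apply/eqP => tu; move: ut; rewrite -tu /= subrr normr0 ltxx.
Qed.

Lemma derivI_eq f t l : diffq f t @ t^' --> l -> derivI f t = l.
Proof.
move=> fl; have := I_dnbhs_proper t => P.
by apply: cvg_lim.
Qed.

Lemma derivI_cvg f t : derivableI f -> diffq f t @ t^' --> derivI f t.
Proof. by move=> /(_ t). Qed.

Lemma cvg_mulmx (A : 'M[R]_3) (T : Type) (F : set_system T) (h : T -> E) (l : E) :
  Filter F -> h @ F --> l -> (fun s => A *m h s) @ F --> A *m l.
Proof.
move=> FF hl.
have AE v : A *m v = v 0 0 *: col 0 A + v 1 0 *: col 1 A + v 2%:R 0 *: col 2%:R A.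
  by apply/colP => i; rewrite !mxE sum3; ring.
have cl j : h s j 0 @[s --> F] --> l j 0.
  by apply: (cvg_comp h (fun v : E => v j 0) hl); exact: coord_continuous.
under eq_fun do rewrite AE.
by rewrite AE; do !apply: cvgD; apply: cvgZr_tmp; exact: cl.
Qed.

Lemma diffq_affine f g t r A c : (forall s : I, g s = r *: (A *m f s) + c) ->
  diffq g t = fun s => (r *: A) *m diffq f t s.
Proof.
move=> gE; apply/funext => s; rewrite /diffq !gE -scalemxAr -scalemxAl mulmxBr.
by rewrite opprD addrACA subrr addr0 -scalerBr !scalerA mulrC.
Qed.

Lemma derivI_affine f g r A c : derivableI f ->
  (forall s : I, g s = r *: (A *m f s) + c) ->
  forall t, derivI g t = r *: (A *m derivI f t).
Proof.
move=> df gE t; apply: derivI_eq; rewrite (diffq_affine _ gE) scalemxAl.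
apply: cvg_mulmx; exact: derivI_cvg.
Qed.

End SmoothPaths.

Section Loops.
Variable R : realType.
Local Notation E := 'cV[R]_3.
Local Notation I := (set_type (@interval02 R)).

Lemma interval02P (x : R) : 0 <= x <= 2 -> interval02 x.
Proof. by []. Qed.

Definition mkI (x : R) (x02 : 0 <= x <= 2) : I :=
  exist _ x (mem_set (interval02P x02)).

Lemma periodicz (G : R -> E) : (forall x, G (x + 2) = G x) ->
  forall (k : int) x, G (x + k%:~R * 2) = G x.
Proof.
move=> Gp k x.
have Gn (n : nat) y : G (y + n%:R * 2) = G y.
  elim: n y => [|n IH] y; first by rewrite mul0r addr0.
  by rewrite -[in RHS]IH -[in RHS]Gp -natr1; congr G; ring.
case: k => n; first exact: Gn.
by rewrite -(Gn n.+1) NegzE mulrNz; congr G; rewrite -pmulrn; ring.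
Qed.

Lemma floor2 (x : R) :
  exists2 k : int, 0 <= x - k%:~R * 2 & x - k%:~R * 2 < 2.
Proof.
exists (Num.floor (x / 2)).
  by have := floor_le (x / 2); lra.
by have := floorD1_gt (x / 2); rewrite intrD; lra.
Qed.

Lemma floor_half0 (x : R) : 0 <= x -> x < 2 -> Num.floor (x / 2) = 0.
Proof.
move=> x0 x2; apply: floor_def; rewrite add0r mulr0z mulr1z.
by apply/andP; split; lra.
Qed.

Lemma periodic_extension (f : I -> E) : f (pt0 R) = f (pt2 R) ->
  exists2 G : R -> E, (forall x, G (x + 2) = G x) & forall t : I, f t = G (\val t).
Proof.
move=> f02.
pose w (x : R) := x - (Num.floor (x / 2))%:~R * 2.
pose F (x : R) : E := if pselect (interval02 x) is left h
  then f (exist _ x (mem_set h)) else f (pt0 R).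
have FE t : F (\val t) = f t.
  rewrite /F; case: pselect => [h|]; last by have /set_mem := valP t.
  by congr f; apply: val_inj.
exists (F \o w) => [x|t] /=.
  congr F; rewrite /w (_ : (x + 2) / 2 = x / 2 + 1%:~R); last by rewrite mulrDl divff.
  by rewrite floorDrz ?intr_int // intrKfloor intrD; ring.
have [t2|t2] := eqVneq (\val t) 2.
  have -> : t = pt2 R by apply: val_inj.
  rewrite -f02 -FE /w /= divff // (_ : 1 = 1%:~R :> R) // intrKfloor.
  by rewrite mul1r subrr.
have /andP[t0 tle2] : 0 <= \val t <= 2 := set_mem (valP t).
rewrite -FE /w (_ : Num.floor _ = 0) ?mul0r ?subr0 //.
have {t2 tle2} : \val t < 2 by rewrite lt_neqAle t2.
exact: floor_half0.
Qed.

Lemma smooth_circle_primitive (f : I -> E) : derivableI f ->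
  smooth_circle (derivI f) -> f (pt0 R) = f (pt2 R) -> smooth_circle f.
Proof.
move=> df [g [gs gp gE]] f02; have [G Gp GE] := periodic_extension f02.
have dG0 (x : R) : 0 <= x < 2 -> forall e : R, 0 < e -> exists2 d : R, 0 < d &
    forall h : R, h != 0 -> `|h| < d -> `|g x - h^-1 *: (G (h + x) - G x)| < e.
  move=> /andP[x0 x2] e e0.
  have xI : 0 <= x <= 2 by rewrite x0 ltW.
  pose t : I := mkI xI.
  have [d1 d10 H1] := (diffq_cvgP f t _).1 (@derivI_cvg R f t df) e e0.
  have near_t (h : R) : h != 0 -> `|h| < d1 -> 0 <= h + x <= 2 ->
      `|g x - h^-1 *: (G (h + x) - G x)| < e.
    move=> h0 hd hx; pose s : I := mkI hx.
    have := H1 s; rewrite gE /diffq !GE /= addrK; apply => //.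
    by apply: contra h0 => /eqP/(congr1 \val) /= /eqP; rewrite -subr_eq0 addrK.
  have [{}x0|xn0] := eqVneq x 0; last first.
    have {xn0} xpos : 0 < x by rewrite lt_neqAle eq_sym xn0.
    exists (Num.min d1 (Num.min x (2 - x))).
      by rewrite !lt_min d10 xpos subr_gt0 x2.
    move=> h h0; rewrite !lt_min => /and3P[hd hx h2]; apply: near_t => //.
    by move: hx h2; rewrite !ltr_norml => /andP[? ?] /andP[? ?]; apply/andP; split; lra.
  have [d2 d20 H2] := (diffq_cvgP f (pt2 R) _).1 (@derivI_cvg R f (pt2 R) df) e e0.
  exists (Num.min d1 (Num.min d2 1)); first by rewrite !lt_min d10 d20 ltr01.
  move=> h h0; rewrite !lt_min => /and3P[hd1 hd2 h1].
  move: (h1); rewrite ltr_norml => /andP[h1l h1r].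
  have [hp|hn] := leP 0 h.
    by apply: near_t => //; rewrite x0 addr0; apply/andP; split; lra.
  have h2I : 0 <= h + 2 <= 2 by apply/andP; split; lra.
  pose s : I := mkI h2I.
  have := H2 s; rewrite gE /diffq !GE /= addrK Gp x0 addr0.
  rewrite -(gp 0) add0r -(Gp 0) add0r; apply => //.
  by apply: contra h0 => /eqP/(congr1 \val) /= /eqP; rewrite -subr_eq0 addrK.
have dG (x : R) : is_derive x 1 G (g x).
  have [k k0 k2] := floor2 x.
  have xE : x = x - k%:~R * 2 + k%:~R * 2 by rewrite subrK.
  have cv : h^-1 *: ((G \o shift x) (h *: (1 : R)) - G x) @[h --> 0^'] --> g x.
    apply/cvgrPdist_lt => e e0.
    have kk : 0 <= x - k%:~R * 2 < 2 by rewrite k0.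
    have [d d0 H] := dG0 _ kk e e0.
    apply/nbhs_ballP; exists d => // h /= hd h0.
    rewrite xE addrA !(periodicz Gp) (periodicz gp) [h *: _]mulr1; apply: H => //.
    by move: hd; rewrite /ball /= sub0r normrN.
  by apply: DeriveDef; [exact: cvgP cv|exact: cvg_lim cv].
exists G; split=> //; case=> [|k] x.
  exact: (@ex_derive _ _ _ _ _ _ _ (dG x)).
rewrite /derive1n iterSr (_ : G^`()%classic = g); first exact: gs.
by apply/funext => y; rewrite derive1E; have [] := dG y.
Qed.

End Loops.

Section Spaces.
Variable R : realType.
Local Notation E := 'cV[R]_3.
Local Notation I := (set_type (@interval02 R)).

Record smooth_map := SmoothMap { smap :> I -> E; smapP : smoothI smap }.

HB.instance Definition _ := gen_eqMixin smooth_map.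
HB.instance Definition _ := gen_choiceMixin smooth_map.

Definition jet (f : smooth_map) :
  prod_topology (fun _ : nat => {uniform I -> E}) := fun k => iter k (@derivI R) f.

(* The C^oo topology: uniform convergence of all derivatives on [0, 2]. *)
HB.instance Definition _ := Topological.copy smooth_map (initial_topology jet).

Lemma smap_derivable (f : smooth_map) : derivableI f.
Proof. exact: (@smapP f 0%N). Qed.

Definition immersion (f : smooth_map) : Prop := forall t, derivI f t != 0.

Definition framed_path : set (smooth_map * smooth_map) :=
  [set p : smooth_map * smooth_map |
    [/\ immersion p.1,
        forall t, enorm (p.2 t) = 1 &
        forall t, dot (p.2 t) (derivI p.1 t) = 0]].

Definition curve (p : framed_path) : smooth_map := (\val p).1.

Definition frame (p : framed_path) : smooth_map := (\val p).2.

Definition translated (p q : framed_path) : Prop :=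
  (exists c : E, forall t, curve q t = curve p t + c) /\ frame q = frame p.

Definition framed_loop : set framed_path :=
  [set p : framed_path |
    [/\ smooth_circle (derivI (curve p)),
        smooth_circle (frame p) &
        curve p (pt0 R) = curve p (pt2 R)]].

Lemma translated_refl p : translated p p.
Proof. by split=> //; exists 0 => t; rewrite addr0. Qed.

Lemma translated_sym p q : translated p q -> translated q p.
Proof.
move=> [[c pq] Vpq]; split=> //; exists (- c) => t.
by rewrite pq addrK.
Qed.

Lemma translated_trans p q r : translated p q -> translated q r -> translated p r.
Proof.
move=> [[c pq] Vpq] [[d qr] Vqr]; split; last by rewrite Vqr.
by exists (c + d) => t; rewrite qr pq addrA.
Qed.

Definition translated_equiv : equiv_rel framed_path :=
  equiv_of_Prop translated_refl translated_sym translated_trans.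

Definition spaceO : Type := quotient_topology {eq_quot translated_equiv}.
HB.instance Definition _ := Topological.copy spaceO
  (quotient_topology {eq_quot translated_equiv}).
HB.instance Definition _ := Quotient.copy spaceO
  (quotient_topology {eq_quot translated_equiv}).

Definition spaceC : set spaceO := [set \pi_spaceO p | p in framed_loop].

Definition conormal (p : framed_path) (t : I) : E :=
  cross ((enorm (derivI (curve p) t))^-1 *: derivI (curve p) t) (frame p t).

Definition twist (theta : R) (p : framed_path) (t : I) : E :=
  cos (2 * theta) *: frame p t + sin (2 * theta) *: conormal p t.

(* q is the image of p, up to translation, under the action of
   (A, r, e^{i theta}) in SO(3) x R^+ x S^1. *)
Definition framed_similar (p q : framed_path) : Prop :=
  exists (A : 'M[R]_3) (r theta : R) (c : E),
    [/\ SO3 A, 0 < r,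
        forall t, curve q t = r *: (A *m curve p t) + c &
        forall t, frame q t = A *m twist theta p t].

Lemma translated_derivI p q : translated p q ->
  derivI (curve q) = derivI (curve p).
Proof.
move=> [[c pq] _]; apply/funext => t.
have pq' s : curve q s = 1 *: (1%:M *m curve p s) + c by rewrite scale1r mul1mx.
by rewrite (derivI_affine (@smap_derivable (curve p)) pq') scale1r mul1mx.
Qed.

Lemma translated_framed_loop p q : translated p q -> framed_loop p -> framed_loop q.
Proof.
move=> pq; have dq := translated_derivI pq; case: pq => [[c pq] Vq] [dp fp p02].
by split; rewrite ?dq ?Vq // !pq p02.
Qed.

Lemma framed_similar_derivI p q A r c :
    (forall t, curve q t = r *: (A *m curve p t) + c) ->
  forall t, derivI (curve q) t = r *: (A *m derivI (curve p) t).
Proof.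
by move=> pq t; exact: derivI_affine (@smap_derivable (curve p)) pq t.
Qed.

Lemma framed_pathP (p : framed_path) :
  [/\ forall t, derivI (curve p) t != 0,
      forall t, enorm (frame p t) = 1 &
      forall t, dot (frame p t) (derivI (curve p) t) = 0].
Proof. exact: set_mem (valP p). Qed.

Lemma framed_similar_conormal p q A r theta c : SO3 A -> 0 < r ->
    (forall t, curve q t = r *: (A *m curve p t) + c) ->
    (forall t, frame q t = A *m twist theta p t) ->
  forall t, conormal q t =
    A *m (cos (2 * theta) *: conormal p t - sin (2 * theta) *: frame p t).
Proof.
move=> sA r0 pq Vq t; have [imm nV pV] := framed_pathP p.
have dn0 : enorm (derivI (curve p) t) != 0.
  by rewrite gt_eqF // /enorm sqrtr_gt0 dot_gt0.
rewrite /conormal (framed_similar_derivI pq) enormZ ?ltW // enorm_SO3 // Vq.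
rewrite invfM scalerA mulrAC mulVf ?gt_eqF // mul1r scalemxAr crossM //.
rewrite /twist cross_lin /conormal; set u := _ *: derivI _ _.
rewrite cross_cross ?scalerN //.
  by rewrite /u dotZl dotZr mulrA -invfM -expr2 sqr_sqrtr ?dot_ge0 // mulVf // gt_eqF ?dot_gt0.
by rewrite /u dotZr pV mulr0.
Qed.

Lemma framed_similar_refl p : framed_similar p p.
Proof.
exists 1%:M, 1, 0, 0; split=> // [|t|t]; first exact: SO3_1.
  by rewrite scale1r mul1mx addr0.
by rewrite mul1mx /twist mulr0 cos0 sin0 scale1r scale0r addr0.
Qed.

Lemma framed_similar_trans p q s :
  framed_similar p q -> framed_similar q s -> framed_similar p s.
Proof.
move=> [A [r [a [c [sA r0 pq Vq]]]]] [B [r' [b [d [sB r'0 qs Vs]]]]].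
exists (B *m A), (r' * r), (b + a), (r' *: (B *m c) + d); split=> [| |t|t].
- exact: SO3_M.
- exact: mulr_gt0.
- rewrite qs pq mulmxDr scalerDr -addrA -scalemxAr scalerA mulmxA //.
- rewrite Vs -mulmxA; congr mulmx.
  rewrite {1}/twist Vq (framed_similar_conormal sA r0 pq Vq).
  rewrite !scalemxAr -mulmxDr; congr mulmx.
  rewrite /twist mulrDr cosD sinD.
  by apply/colP => i; rewrite !mxE; ring.
Qed.

Lemma framed_similar_sym p q : framed_similar p q -> framed_similar q p.
Proof.
move=> [A [r [a [c [sA r0 pq Vq]]]]].
have AA := SO3_trmxM sA.
exists A^T, r^-1, (- a), (- (r^-1 *: (A^T *m c))); split=> [| |t|t].
- exact: SO3_tr.
- by rewrite invr_gt0.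
- rewrite pq mulmxDr scalerDr addrK -scalemxAr scalerA mulVf ?gt_eqF //.
  by rewrite scale1r mulmxA AA mul1mx.
- rewrite {1}/twist Vq (framed_similar_conormal sA r0 pq Vq) mulmxDr.
  rewrite -!scalemxAr !mulmxA AA !mul1mx /twist mulrN cosN sinN.
  have := cos2Dsin2 (2 * a); set C := cos _; set S := sin _ => CS.
  by apply/colP => i; rewrite !mxE -[LHS]mul1r -CS; ring.
Qed.

(* framed_similar is invariant under translation of either argument, so the
   choice of representatives is immaterial: see framed_loop_similarE. *)
Definition framed_loop_similar (x y : spaceC) : Prop :=
  framed_similar (repr (\val x)) (repr (\val y)).

Definition framed_loop_similar_equiv : equiv_rel spaceC :=
  @equiv_of_Prop spaceC framed_loop_similar
    (fun x => @framed_similar_refl _)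
    (fun x y => @framed_similar_sym _ _)
    (fun x y z => @framed_similar_trans _ _ _).

Definition spaceM : Type := quotient_topology {eq_quot framed_loop_similar_equiv}.
HB.instance Definition _ := Topological.copy spaceM
  (quotient_topology {eq_quot framed_loop_similar_equiv}).
HB.instance Definition _ := Quotient.copy spaceM
  (quotient_topology {eq_quot framed_loop_similar_equiv}).

Definition immersed_loop : set smooth_map :=
  [set f : smooth_map | smooth_circle f /\ immersion f].

Definition similar (f g : immersed_loop) : Prop :=
  exists (A : 'M[R]_3) (r : R) (c : E),
    [/\ SO3 A, 0 < r & forall t, \val g t = r *: (A *m \val f t) + c].

Lemma similar_refl f : similar f f.
Proof.
exists 1%:M, 1, 0; split=> //; first exact: SO3_1.
by move=> t; rewrite scale1r mul1mx addr0.
Qed.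

Lemma similar_sym f g : similar f g -> similar g f.
Proof.
move=> [A [r [c [sA r0 fg]]]].
exists A^T, r^-1, (- (r^-1 *: (A^T *m c))); split=> [| |t].
- exact: SO3_tr.
- by rewrite invr_gt0.
- rewrite fg mulmxDr scalerDr addrK -scalemxAr scalerA mulVf ?gt_eqF //.
  by rewrite scale1r mulmxA SO3_trmxM // mul1mx.
Qed.

Lemma similar_trans f g h : similar f g -> similar g h -> similar f h.
Proof.
move=> [A [r [c [sA r0 fg]]]] [B [r' [d [sB r'0 gh]]]].
exists (B *m A), (r' * r), (r' *: (B *m c) + d); split=> [| |t].
- exact: SO3_M.
- exact: mulr_gt0.
- by rewrite gh fg mulmxDr scalerDr -addrA -scalemxAr scalerA mulmxA.
Qed.

Definition similar_equiv : equiv_rel immersed_loop :=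
  equiv_of_Prop similar_refl similar_sym similar_trans.

Definition spaceB : Type := quotient_topology {eq_quot similar_equiv}.
HB.instance Definition _ := Topological.copy spaceB
  (quotient_topology {eq_quot similar_equiv}).
HB.instance Definition _ := Quotient.copy spaceB
  (quotient_topology {eq_quot similar_equiv}).

Lemma repr_translated (p : framed_path) : translated p (repr (\pi_spaceO p)).
Proof.
suff /asboolP : translated_equiv p (repr (\pi_spaceO p)) by [].
by apply/eqmodP; rewrite [RHS]reprK.
Qed.

Lemma repr_framed_loop (x : spaceC) : framed_loop (repr (\val x)).
Proof.
have [p lp <-] := set_mem (valP x).
exact: translated_framed_loop (repr_translated p) lp.
Qed.

Lemma framed_loop_immersed (p : framed_path) : framed_loop p -> immersed_loop (curve p).
Proof.
move=> [dp _ p02]; have [imm _ _] := framed_pathP p; split=> //.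
exact: smooth_circle_primitive (@smap_derivable (curve p)) dp p02.
Qed.

Definition loop_of (p : framed_path) (lp : framed_loop p) : immersed_loop :=
  exist _ (curve p) (mem_set (framed_loop_immersed lp)).

Definition framed_loop_class (p : framed_path) (lp : framed_loop p) : spaceC :=
  exist _ (\pi_spaceO p) (mem_set (imageP _ lp)).

(* The forget-framing map [gamma, V] |-> [gamma]; see forgetE. *)
Definition forget (m : spaceM) : spaceB :=
  \pi_spaceB (loop_of (repr_framed_loop (repr m))).

Lemma translated_similar (p q : framed_path) : translated p q -> framed_similar p q.
Proof.
move=> [[c pq] Vpq]; exists 1%:M, 1, 0, c; split=> // [|t|t]; first exact: SO3_1.
  by rewrite scale1r mul1mx.
by rewrite mul1mx /twist mulr0 cos0 sin0 scale1r scale0r addr0 Vpq.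
Qed.

Lemma framed_loop_similarE (p q : framed_path) (lp : framed_loop p) (lq : framed_loop q) :
  framed_loop_similar (framed_loop_class lp) (framed_loop_class lq) <->
  framed_similar p q.
Proof.
have pP := translated_similar (repr_translated p).
have qP := translated_similar (repr_translated q).
split=> pq; last exact: framed_similar_trans (framed_similar_trans (framed_similar_sym pP) pq) qP.
exact: framed_similar_trans (framed_similar_trans pP pq) (framed_similar_sym qP).
Qed.

Lemma forgetE (p : framed_path) (lp : framed_loop p) :
  forget (\pi_spaceM (framed_loop_class lp)) = \pi_spaceB (loop_of lp).
Proof.
set x := framed_loop_class lp; set y := repr (\pi_spaceM x).
have /asboolP xy : framed_loop_similar_equiv x y by apply/eqmodP; rewrite [RHS]reprK.
have [A [r [theta [c [sA r0 xyE _]]]]] := xy.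
have [[d pd] _] := repr_translated p.
apply/esym/eqmodP/asboolP.
exists A, r, (r *: (A *m d) + c); split=> // t.
by rewrite xyE pd mulmxDr scalerDr addrA.
Qed.

End Spaces.

(* Main.v *)
Require Import Defs.
From mathcomp Require Import all_boot all_order all_algebra.
From mathcomp Require Import all_classical all_reals all_analysis.
From mathcomp Require Import ring lra.
Set Implicit Arguments.
Unset Strict Implicit.
Unset Printing Implicit Defensive.
Import Order.TTheory GRing.Theory Num.Theory.
Import numFieldNormedType.Exports.
Local Open Scope classical_set_scope.
Local Open Scope ring_scope.
Local Open Scope quotient_scope.

(** The framings of a loop are told apart, up to homotopy, by how many full
turns they make, and transporting a framing around a well chosen closed path of
loops changes this number; so no choice of framings can be continuous.

The turns are measured by the total twist, the integral over [0, 2] of the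
product of V' with T x V, where T is the unit tangent.  It is continuous on
framed paths (total_twist_continuous) and unchanged by translations, rotations,
dilations and constant twists of the frame (total_twist_similar), so it is a
continuous function on the moduli space (moduli_twist_continuous).  The angle
between two framings of the same loop closes up, so their total twists agree
modulo 2 pi, hence modulo pi.  In particular, if a constant unit vector e is never tangent to a
loop, its projections to the normal planes give a framing whose total twist is
an explicit integral, and for any section sigma the twist of the class
sigma [gamma] differs from this integral by a multiple of pi
(moduli_twist_projected).  Along a path of such loops this multiple is
constant.

The closed path is built from the loops

  gamma_(a, b) (t) = (cos (pi t), a sin (pi t), b sin (2 pi t)),

with coordinates numbered 0, 1, 2.  Axis 1 is never tangent to gamma_(a, b) when
b is nonzero, and axis 2 is never tangent to it when a is nonzero.  The segment
b = 1, with a from -1 to 1, and the segment a = 1, with b from -1 to 1, have the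
same end points in the space of loops up to similarity: they share
gamma_(1, 1), and gamma_(-1, 1) is carried to gamma_(1, -1) by the half turn
about axis 0.  Let w_j be the integral attached to the projected axis j, at
a = b = 1.  A reflection reverses the sign of the twist, so the integral runs
from - w_1 to w_1 along the first segment and from - w_2 to w_2 along the second
one.  A continuous section would therefore force 2 w_1 = 2 w_2.  But w_1 - w_2
is the angle swept by the plane curve that records the angle between the two
projected axes, and the symmetry t -> t + 1 of gamma_(1, 1) makes this curve
odd: it makes a nonzero angle in half a period and the same angle again in the
other half (loop_integral_neq). *)

(** * Continuity and derivatives of pointwise expressions *)

Section PointwiseContinuity.
Variables (R : realType) (T : topologicalType).
Implicit Types f g : T -> R.

Lemma continuous_addf f g : continuous f -> continuous g -> continuous (fun z => f z + g z).
Proof. by move=> cf cg z; exact: (cvgD (cf z) (cg z)). Qed.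

Lemma continuous_mulf f g : continuous f -> continuous g -> continuous (fun z => f z * g z).
Proof. by move=> cf cg z; exact: (cvgM (cf z) (cg z)). Qed.

Lemma continuous_oppf f : continuous f -> continuous (fun z => - f z).
Proof. by move=> cf z; exact: (cvgN (cf z)). Qed.

Lemma continuous_invf f : continuous f -> (forall z, f z != 0) -> continuous (fun z => (f z)^-1).
Proof. by move=> cf f0 z; exact: (cvgV (f0 z) (cf z)). Qed.

Lemma continuous_cstf (a : R) : continuous (fun _ : T => a).
Proof. by move=> z; exact: cvg_cst. Qed.

Lemma continuous_idf : continuous (fun z : T => z).
Proof. by move=> z; exact: cvg_id. Qed.

Lemma continuous_compf (F : R -> R) f : continuous F -> continuous f ->
  continuous (fun z => F (f z)).
Proof. by move=> cF cf z; apply: (continuous_comp (cf z)); exact: cF. Qed.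

Lemma continuous_sqrtf f : continuous f -> continuous (fun z => Num.sqrt (f z)).
Proof. by move=> cf; apply: continuous_compf => //; exact: sqrt_continuous. Qed.

Lemma continuous_cosf f : continuous f -> continuous (fun z => cos (f z)).
Proof. by move=> cf; apply: continuous_compf => //; exact: continuous_cos. Qed.

Lemma continuous_sinf f : continuous f -> continuous (fun z => sin (f z)).
Proof. by move=> cf; apply: continuous_compf => //; exact: continuous_sin. Qed.

Lemma continuous_expRf f : continuous f -> continuous (fun z => expR (f z)).
Proof. by move=> cf; apply: continuous_compf => //; exact: continuous_expR. Qed.

End PointwiseContinuity.

Ltac continuity :=
  lazymatch goal with
  | |- continuous (fun _ => ?a) => exact (@continuous_cstf _ _ a)
  | |- continuous (fun z => z) => exact (@continuous_idf _)
  | |- continuous (fun z => GRing.add (@?f z) (@?g z)) =>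
      refine (@continuous_addf _ _ f g _ _); continuity
  | |- continuous (fun z => GRing.mul (@?f z) (@?g z)) =>
      refine (@continuous_mulf _ _ f g _ _); continuity
  | |- continuous (fun z => GRing.opp (@?f z)) =>
      refine (@continuous_oppf _ _ f _); continuity
  | |- continuous (fun z => GRing.inv (@?f z)) =>
      refine (@continuous_invf _ _ f _ _); [continuity|]
  | |- continuous (fun z => cos (@?f z)) => refine (@continuous_cosf _ _ f _); continuity
  | |- continuous (fun z => sin (@?f z)) => refine (@continuous_sinf _ _ f _); continuity
  | |- continuous (fun z => expR (@?f z)) => refine (@continuous_expRf _ _ f _); continuity
  | |- continuous (fun z => Num.sqrt (@?f z)) => refine (@continuous_sqrtf _ _ f _); continuity
  | |- _ => try assumption
  end.

Section PointwiseDerivatives.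
Variable R : realType.
Implicit Types (f g : R -> R) (x a b : R).

Lemma is_derive1M f g x a b : is_derive x (1 : R) f a -> is_derive x (1 : R) g b ->
  is_derive x (1 : R) (fun t => f t * g t) (f x * b + g x * a).
Proof. by move=> df dg; exact: (@is_deriveM _ _ f g x 1 a b df dg). Qed.

Lemma is_derive1D f g x a b : is_derive x (1 : R) f a -> is_derive x (1 : R) g b ->
  is_derive x (1 : R) (fun t => f t + g t) (a + b).
Proof. by move=> df dg; exact: (@is_deriveD _ _ _ f g x 1 a b df dg). Qed.

Lemma is_derive1N f x a : is_derive x (1 : R) f a ->
  is_derive x (1 : R) (fun t => - f t) (- a).
Proof. by move=> df; exact: (@is_deriveN _ _ _ f x 1 a df). Qed.

Lemma is_derive1V f x a : f x != 0 -> is_derive x (1 : R) f a ->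
  is_derive x (1 : R) (fun t => (f t)^-1) (- (f x) ^- 2 * a).
Proof. by move=> fx0 df; exact: is_deriveV. Qed.

Lemma is_derive1_fcomp f g x a b : is_derive (g x) (1 : R) f a ->
  is_derive x (1 : R) g b -> is_derive x (1 : R) (fun t => f (g t)) (a * b).
Proof. by move=> df dg; exact: (@is_derive1_comp _ f g x a b df dg). Qed.

End PointwiseDerivatives.

(** * Integrals over [0, 2] *)

Section Integral02.
Variable R : realType.
Implicit Types f g F G : R -> R.

Definition integral02 f : R := \int[lebesgue_measure]_(x in `[0, 2]) f x.

(** Derivatives are asked for inside the interval only: a path on [0, 2] that is
extended to the line by its end values has corners at 0 and 2. *)
Definition primitive02 F f : Prop :=
  continuous F /\ forall x : R, x \in `]0, 2[%R -> is_derive x (1 : R) F (f x).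

Lemma primitive02_mvt F f (t : R) : primitive02 F f -> 0 <= t <= 2 ->
  exists2 c : R, 0 <= c <= 2 & F t - F 0 = f c * t.
Proof.
move=> [cF dF] /andP[t0 t2].
have dFt (x : R) : x \in `]0, t[%R -> is_derive x (1 : R) F (f x).
  by rewrite in_itv /= => /andP[x0 xt]; apply: dF; rewrite in_itv /= x0 (lt_le_trans xt).
have cFt : {within `[0, t], continuous F} by exact: continuous_subspaceT.
have [c ct FE] := MVT_segment t0 dFt cFt.
exists c; last by rewrite FE subr0.
by move: ct; rewrite in_itv /= => /andP[-> ct]; rewrite (le_trans ct).
Qed.

Lemma primitive02_cst F : primitive02 F (fun=> 0) -> forall t : R, 0 <= t <= 2 -> F t = F 0.
Proof.
move=> pF t t02; have [c _ /eqP] := primitive02_mvt pF t02.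
by rewrite mul0r subr_eq0 => /eqP.
Qed.

Lemma integral02_primitive F f : continuous f -> primitive02 F f ->
  integral02 f = F 2 - F 0.
Proof.
move=> cf [cF dF].
rewrite /integral02 /Rintegral (@continuous_FTC2 _ f F) //.
- exact: continuous_subspaceT.
- split=> [x x02| |].
  + by have [] := dF x x02.
  + by apply: cvg_at_right_filter; exact: cF.
  + by apply: cvg_at_left_filter; exact: cF.
- by move=> x /dF dFx; rewrite derive1E; exact: derive_val.
Qed.

Definition clampR (x : R) : R := Num.max 0 (Num.min x 2).

Lemma clampR_id (x : R) : 0 <= x <= 2 -> clampR x = x.
Proof. by case/andP=> x0 x2; rewrite /clampR min_l // max_r. Qed.

Lemma clampR02 (x : R) : 0 <= clampR x <= 2.
Proof. by rewrite /clampR le_max lexx /= ge_max ler0n /= ge_min lexx orbT. Qed.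

Lemma clampR_continuous : continuous clampR.
Proof.
move=> x.
have cmin : {for x, continuous ((id : R -> R^o) \min (cst 2 : R -> R^o))}.
  by apply: continuous_min => //; exact: cst_continuous.
have := @continuous_max R R (cst 0 : R -> R^o) _ x _ cmin.
by apply; exact: cst_continuous.
Qed.

Lemma primitive02_exists f : continuous f ->
  exists2 F, primitive02 F f & F 0 = 0.
Proof.
move=> cf.
(* Starting at -1 makes G differentiable at 0 as well. *)
pose G (x : R) : R := \int[lebesgue_measure]_(t in `[-1, x]) f t.
have dG (x : R) : 0 <= x <= 2 -> is_derive x (1 : R) G (f x).
  move=> /andP[x0 x2].
  have intf : lebesgue_measure.-integrable `[-1, 3] (EFin \o f).
    apply: continuous_compact_integrable; first exact: segment_compact.
    exact: continuous_subspaceT.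
  have [||dGx GE] := continuous_FTC1_closed _ intf _ (cf x); [lra|lra|].
  by apply: DeriveDef; [exact: dGx|rewrite -derive1E GE].
exists (fun x => G (clampR x) - G 0); last first.
  by rewrite clampR_id ?subrr // lexx ler0n.
split=> [x|x x02].
  have cGx : {for x, continuous (G \o clampR)}.
    apply: continuous_comp; first exact: clampR_continuous.
    apply/differentiable_continuous/derivable1_diffP.
    by have [] := dG _ (clampR02 x).
  exact: (cvgB cGx (cvg_cst _)).
have x02' : 0 <= x <= 2 by move: x02; rewrite in_itv /= => /andP[/ltW -> /ltW ->].
apply: (@near_eq_is_derive _ _ _ (fun y => G y + - G 0)); last first.
  rewrite -[f x]addr0; apply: is_derive1D; exact: dG.
near=> y; rewrite clampR_id //.
have : y \in `]0, 2[%R by near: y; exact: near_in_itvoo.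
by rewrite in_itv /= => /andP[/ltW -> /ltW ->].
Unshelve. all: by end_near. Qed.

Lemma integral02_mvt f : continuous f ->
  exists2 c : R, 0 <= c <= 2 & integral02 f = f c * 2.
Proof.
move=> cf; have [F pF _] := primitive02_exists cf.
have [|c c02 FE] := primitive02_mvt pF (t := 2); first by rewrite ler0n lexx.
by exists c => //; rewrite (integral02_primitive cf pF).
Qed.

Lemma eq_integral02 f g : continuous f -> continuous g ->
  (forall t, 0 < t < 2 -> f t = g t) -> integral02 f = integral02 g.
Proof.
move=> cf cg fg; have [F pF _] := primitive02_exists cf.
rewrite (integral02_primitive cf pF) (@integral02_primitive F g) //.
split=> [|x x02]; first exact: pF.1.
by rewrite -fg; [exact: pF.2|rewrite in_itv in x02].
Qed.

Lemma integral02B f g : continuous f -> continuous g ->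
  integral02 (fun t => f t - g t) = integral02 f - integral02 g.
Proof.
move=> cf cg; have [F pF F0] := primitive02_exists cf.
have [G pG G0] := primitive02_exists cg.
rewrite (integral02_primitive cf pF) (integral02_primitive cg pG).
rewrite (@integral02_primitive (fun t => F t - G t)) ?F0 ?G0 ?subr0 //.
  by move=> x; apply: cvgB; [exact: cf|exact: cg].
split=> x; first by apply: cvgB; [exact: pF.1|exact: pG.1].
by move=> x02; apply: is_derive1D; [exact: pF.2|exact/is_derive1N/pG.2].
Qed.

Lemma integral02N f : continuous f ->
  integral02 (fun t => - f t) = - integral02 f.
Proof.
move=> cf; have [F pF F0] := primitive02_exists cf.
rewrite (integral02_primitive cf pF).
rewrite (@integral02_primitive (fun t => - F t)) ?F0 ?oppr0 ?addr0 //.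
  by move=> x; apply: cvgN; exact: cf.
split=> x; first by apply: cvgN; exact: pF.1.
by move=> x02; exact/is_derive1N/pF.2.
Qed.

(** Since [0, 2] is compact, joint continuity makes the integrands uniformly close. *)
Lemma integral02_parameter_continuous (T : topologicalType) (G : T -> R -> R) :
  continuous (fun z : T * R => G z.1 z.2) -> continuous (fun q => integral02 (G q)).
Proof.
move=> cG p.
have cGq q : continuous (G q).
  move=> x; apply: (@continuous_comp _ _ _ (fun y => (q, y)) (fun z : T * R => G z.1 z.2)).
    exact: (cvg_pair (cvg_cst q) cvg_id).
  exact: cG.
apply/cvgrPdist_lt => e e0.
have cover := (@compact_near_coveringP R `[0, 2]%classic).1 (@segment_compact R 0 2)
  T (nbhs p) (fun q x => `|G p x - G q x| < e / 3) _.
have {}cover : \forall q \near nbhs p,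
    `[0, 2]%classic `<=` (fun x : R => `|G p x - G q x| < e / 3).
  apply: cover => x _.
  have e6 : 0 < e / 6 by lra.
  have /cvgrPdist_lt/(_ _ e6) [[P Q] /= [pP xQ] PQ] := cG (p, x).
  have /cvgrPdist_lt/(_ _ e6) xB := cGq p x.
  exists (Q `&` [set y | `|G p x - G p y| < e / 6], P) => /=.
    by split=> //; exact: filterI.
  move=> [y q] /= [[Qy yB] Pq].
  have qy : `|G p x - G q y| < e / 6 by exact: (PQ (q, y)).
  have -> : G p y - G q y = (G p x - G q y) - (G p x - G p y) by ring.
  by have := ler_normB (G p x - G q y) (G p x - G p y); lra.
near=> q.
rewrite -integral02B; [|exact: cGq..].
have [|c c02 ->] := @integral02_mvt (fun t => G p t - G q t).
  by move=> x; apply: cvgB; exact: cGq.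
have : `|G p c - G q c| < e / 3.
  have : `[0, 2]%classic `<=` (fun x : R => `|G p x - G q x| < e / 3) by near: q.
  by apply; rewrite /= in_itv.
rewrite normrM (ger0_norm (ler0n _ 2)); lra.
Unshelve. all: by end_near. Qed.
End Integral02.

(** * The angle swept by a plane curve *)

Section Winding.
Variable R : realType.
Variables x y dx dy : R -> R.
Hypotheses (px : primitive02 x dx) (py : primitive02 y dy).
Hypotheses (cdx : continuous dx) (cdy : continuous dy).
Hypothesis xy0 : forall t, x t * x t + y t * y t != 0.

Definition angular_velocity t := (x t * dy t - y t * dx t) / (x t * x t + y t * y t).

Lemma angular_velocity_continuous : continuous angular_velocity.
Proof. by case: px py => cx _ [cy _]; rewrite /angular_velocity; continuity. Qed.

(** Polar coordinates without the choice of an argument: let psi and L be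
primitives of the angular velocity and of the logarithmic derivative of the
radius.  Turning the curve back by psi and shrinking it by exp L leaves a curve
with zero derivative. *)
Lemma polar_motion : exists psi L : R -> R,
  [/\ primitive02 psi angular_velocity, psi 0 = 0 &
    forall t, 0 <= t <= 2 ->
      x t = expR (L t) * (x 0 * cos (psi t) - y 0 * sin (psi t)) /\
      y t = expR (L t) * (x 0 * sin (psi t) + y 0 * cos (psi t))].
Proof.
have [[cx dxP] [cy dyP]] := (px, py).
have [psi pT T0] := primitive02_exists angular_velocity_continuous.
pose lam t := (x t * dx t + y t * dy t) / (x t * x t + y t * y t).
have clam : continuous lam by rewrite /lam; continuity.
have [L pL L0] := primitive02_exists clam.
have [[cT dT] [cL dL]] := (pT, pL).
have pP : primitive02
    (fun t => expR (- L t) * (x t * cos (psi t) + y t * sin (psi t))) (fun=> 0).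
  split=> [|t t02]; first by continuity.
  have dxt := dxP _ t02; have dyt := dyP _ t02.
  have dTt := dT _ t02; have dLt := dL _ t02.
  by apply: is_derive_eq; rewrite /lam /angular_velocity /GRing.scale /=; field; exact: xy0.
have pM : primitive02
    (fun t => expR (- L t) * (y t * cos (psi t) - x t * sin (psi t))) (fun=> 0).
  split=> [|t t02]; first by continuity.
  have dxt := dxP _ t02; have dyt := dyP _ t02.
  have dTt := dT _ t02; have dLt := dL _ t02.
  by apply: is_derive_eq; rewrite /lam /angular_velocity /GRing.scale /=; field; exact: xy0.
exists psi, L; split=> // t t02.
have := primitive02_cst pP t02; have := primitive02_cst pM t02.
rewrite /= T0 L0 oppr0 expR0 cos0 sin0 !mul1r !mulr1 !mulr0 subr0 addr0.
move=> <- <-; rewrite expRN.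
have cs := cos2Dsin2 (psi t).
have := expR_gt0 (L t); move: (expR _) => E E0.
have En0 : E != 0 by rewrite gt_eqF.
split.
  by rewrite -[LHS]mulr1 -cs; field.
by rewrite -[LHS]mulr1 -cs; field.
Qed.

(** At time 2 the curve is back at its starting point, so the rotation in its polar
form preserves a direction.  The vanishing of the sine confines the swept angle
to a discrete set. *)
Lemma closed_curve_winding : x 2 = x 0 -> y 2 = y 0 ->
  sin (integral02 angular_velocity) = 0.
Proof.
move=> x20 y20; have [psi [L [ppsi psi0 xyE]]] := polar_motion.
rewrite (integral02_primitive angular_velocity_continuous ppsi) psi0 subr0.
have [|] := xyE 2; first by rewrite ler0n lexx.
rewrite x20 y20; have := xy0 0; have := expR_gt0 (L 2).
move: (x 0) (y 0) (expR _) (sin _) (cos _) => a b E s c E0 ab0 aE bE.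
have : (a * a + b * b) * (E * s) = 0.
  have -> : (a * a + b * b) * (E * s) =
    a * (E * (a * s + b * c)) - b * (E * (a * c - b * s)) by ring.
  by rewrite -aE -bE; ring.
by move/eqP; rewrite !mulf_eq0 (negPf ab0) (gt_eqF E0) /= => /eqP.
Qed.

(** By symmetry the whole angle is twice the angle of the first half, and the first
half cannot have angle 0: the curve would then end on a positive multiple of
its starting point, not on its opposite. *)
Lemma half_turn_winding : x 1 = - x 0 -> y 1 = - y 0 ->
  (forall t, angular_velocity (t + 1) = angular_velocity t) ->
  integral02 angular_velocity != 0.
Proof.
move=> x10 y10 wP; have [psi [L [ppsi psi0 xyE]]] := polar_motion.
rewrite (integral02_primitive angular_velocity_continuous ppsi) psi0 subr0.
(* The increment of psi over half a period is constant; t / 2 runs over [0, 1]. *)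
have pD : primitive02 (fun t => psi (2^-1 * t + 1) - psi (2^-1 * t)) (fun=> 0).
  have [cpsi dpsi] := ppsi; split=> [|t].
    have ch : continuous (fun t : R => 2^-1 * t) by continuity.
    have ch1 : continuous (fun t : R => 2^-1 * t + 1) by continuity.
    apply: continuous_addf; first exact: (continuous_compf cpsi ch1).
    by apply: continuous_oppf; exact: (continuous_compf cpsi ch).
  rewrite in_itv /= => /andP[t0 t2].
  have d1 : is_derive (2^-1 * t + 1) (1 : R) psi (angular_velocity (2^-1 * t + 1)).
    by apply: dpsi; rewrite in_itv /=; apply/andP; split; lra.
  have d2 : is_derive (2^-1 * t) (1 : R) psi (angular_velocity (2^-1 * t)).
    by apply: dpsi; rewrite in_itv /=; apply/andP; split; lra.
  have dh : is_derive t (1 : R) (fun t : R => 2^-1 * t) 2^-1.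
    by apply: is_derive_eq; rewrite /GRing.scale /=; ring.
  have dh1 : is_derive t (1 : R) (fun t : R => 2^-1 * t + 1) 2^-1.
    by apply: is_derive_eq; rewrite /GRing.scale /=; ring.
  have c1 := @is_derive1_fcomp _ psi (fun s => 2^-1 * s + 1) t _ _ d1 dh1.
  have c2 := @is_derive1_fcomp _ psi (fun s => 2^-1 * s) t _ _ d2 dh.
  by have := is_derive1D c1 (is_derive1N c2); rewrite wP subrr.
have /= := primitive02_cst pD (t := 2).
rewrite lexx ler0n mulVf ?pnatr_eq0 // mulr0 add0r psi0 subr0 => /(_ isT) psi2.
have psi21 : psi 2 = 2 * psi 1 by move: psi2; rewrite -(natrD _ 1 1); lra.
rewrite psi21 mulf_neq0 ?pnatr_eq0 //; apply/eqP => psi1.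
have [|] := xyE 1; first by rewrite ler01 ler1n.
rewrite psi1 cos0 sin0 x10 y10; have := xy0 0; have := expR_gt0 (L 1).
move: (x 0) (y 0) (expR _) => a b E E0 ab0 aE bE.
have : (a * a + b * b) * (E + 1) = 0.
  have -> : (a * a + b * b) * (E + 1) = a * (a + E * (a * 1 - b * 0))
    + b * (b + E * (a * 0 + b * 1)) by ring.
  by rewrite -aE -bE; ring.
by move/eqP; rewrite mulf_eq0 (negPf ab0) /= gt_eqF // ltr_wpDr.
Qed.
End Winding.

(** The zeros of the sine are isolated, so h cannot move from one to another. *)
Lemma continuous_sin_eq0 (R : realType) (h : R -> R) : continuous h ->
  (forall s, sin (h s) = 0) -> forall a b, h a = h b.
Proof.
move=> ch sh.
have neq (a b : R) : a <= b -> h a = h b.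
  move=> ab; apply/eqP; apply: contraT => hab.
  have gap (v w : R) : v < w -> sin v = 0 -> exists2 u, v <= u <= w & sin u != 0.
    move=> vw sv; exists (v + Num.min (w - v) (pi / 2)).
      have := pi_gt0 R; have [] := leP (w - v) (pi / 2) => *; apply/andP; split; lra.
    rewrite sinD sv mul0r add0r mulf_neq0 //.
      apply/eqP => cv; have := cos2Dsin2 v; rewrite sv cv => /eqP.
      by rewrite expr0n /= addr0 eq_sym oner_eq0.
    have pi0 := pi_gt0 R; rewrite gt_eqF // sin_gt0_pi //.
    by rewrite lt_min gt_min; apply/andP; split; [apply/andP; split; lra|apply/orP; right; lra].
  have [u mu su] : exists2 u, Num.min (h a) (h b) <= u <= Num.max (h a) (h b) & sin u != 0.
    have [hlt|hlt|hE] := ltgtP (h a) (h b).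
    - by apply: gap.
    - by apply: gap.
    - by rewrite hE eqxx in hab.
  have [c _ hc] := IVT ab (continuous_subspaceT ch) mu.
  by rewrite -hc sh eqxx in su.
move=> a b; have [/neq //|/ltW /neq //] := leP a b.
Qed.

(** * Moving frames *)

Section VectorAlgebra.
Variable R : realType.
Local Notation E := 'cV[R]_3.
Implicit Types u v w e : E.

Definition triple u v w : R := dot u (cross v w).

Lemma dotC u v : dot u v = dot v u.
Proof. by apply: eq_bigr => i _; rewrite mulrC. Qed.

Lemma dot3 u v : dot u v = u 0 0 * v 0 0 + u 1 0 * v 1 0 + u 2%:R 0 * v 2%:R 0.
Proof. exact: sum3. Qed.

Lemma triple3 u v w : triple u v w =
  u 0 0 * (v 1 0 * w 2%:R 0 - v 2%:R 0 * w 1 0)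
  + u 1 0 * (v 2%:R 0 * w 0 0 - v 0 0 * w 2%:R 0)
  + u 2%:R 0 * (v 0 0 * w 1 0 - v 1 0 * w 0 0).
Proof. by rewrite /triple dot3 !mxE !ord3E. Qed.

Lemma triple_SO3 A u v w : SO3 A -> triple (A *m u) (A *m v) (A *m w) = triple u v w.
Proof. by move=> sA; rewrite /triple crossM // dot_SO3. Qed.

Lemma tripleZ (a : R) u v w : triple (a *: u) v (a *: w) = a * a * triple u v w.
Proof. by rewrite !triple3 !mxE; ring. Qed.

Lemma enorm_sqr u : enorm u * enorm u = dot u u.
Proof. by rewrite -expr2 sqr_sqrtr // dot_ge0. Qed.

Lemma enorm_gt0 u : u != 0 -> 0 < enorm u.
Proof. by move=> u0; rewrite sqrtr_gt0 dot_gt0. Qed.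

(** In the orthonormal basis u, V, u x V the identities between scalar and triple
products that follow become identities in a few coordinates. *)
Lemma SO3_frame u V : dot u u = 1 -> dot V V = 1 -> dot V u = 0 ->
  exists2 O : 'M[R]_3, SO3 O &
    O *m u = \col_i (i == 0)%:R /\ O *m V = \col_i (i == 1)%:R.
Proof.
move=> uu VV Vu.
have WW : dot (cross u V) (cross u V) = 1.
  have -> : dot (cross u V) (cross u V) = dot u u * dot V V - dot V u * dot V u.
    by rewrite !dot3 !mxE !ord3E; ring.
  by rewrite uu VV Vu; ring.
have uW : dot u (cross u V) = 0 by rewrite dot3 !mxE !ord3E; ring.
have VW : dot V (cross u V) = 0 by rewrite dot3 !mxE !ord3E; ring.
have [uV Wu WV] : [/\ dot u V = 0, dot (cross u V) u = 0 & dot (cross u V) V = 0].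
  by rewrite dotC Vu dotC uW dotC VW.
pose r (i : 'I_3) := if i == 0 then u else if i == 1 then V else cross u V.
pose O : 'M[R]_3 := \matrix_(i, j) r i j 0.
have OE v i : (O *m v) i 0 = dot (r i) v by rewrite mxE; apply: eq_bigr => k _; rewrite mxE.
exists O; last first.
  by split; apply/colP; apply: ord3P; rewrite OE mxE /r /= ?(uu, VV, uV, Vu, Wu, WV).
split.
  have OO i j : (O *m O^T) i j = dot (r i) (r j).
    by rewrite mxE; apply: eq_bigr => k _; rewrite !mxE.
  apply/matrixP; apply: ord3P; apply: ord3P;
    by rewrite OO mxE /r /= ?(uu, VV, WW, uV, Vu, uW, Wu, VW, WV).
by rewrite det3 !mxE /r /= -WW [in RHS]dot3 !mxE !ord3E; ring.
Qed.

(** The rate at which a frame V with derivative dV turns about the tangent of a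
curve with velocity u. *)
Definition twist_form u V dV : R := triple dV u V / enorm u.

(** The value of the same rate on the normalized projection of the unit vector e to
the planes normal to the velocity u, whose derivative is du. *)
Definition projected_form e u du : R :=
  - (dot e u * triple du u e) / (enorm u * (dot u u - dot e u * dot e u)).

Lemma twist_formM A u V dV : SO3 A ->
  twist_form (A *m u) (A *m V) (A *m dV) = twist_form u V dV.
Proof. by move=> sA; rewrite /twist_form triple_SO3 // enorm_SO3. Qed.

Lemma twist_formZ (r : R) u V dV : 0 < r -> u != 0 ->
  twist_form (r *: u) V dV = twist_form u V dV.
Proof.
move=> r0 u0; have n0 := enorm_gt0 u0; rewrite /twist_form enormZ ?ltW //.
by rewrite !triple3 !mxE; field; rewrite !gt_eqF.
Qed.

Lemma projected_formM A e u du : SO3 A ->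
  projected_form (A *m e) (A *m u) (A *m du) = projected_form e u du.
Proof. by move=> sA; rewrite /projected_form triple_SO3 // enorm_SO3 // !dot_SO3. Qed.

Lemma projected_formZ (r : R) e u (du : E) : 0 < r -> dot e u * dot e u < dot u u ->
  projected_form e (r *: u) (r *: du) = projected_form e u du.
Proof.
move=> r0 eu; have n0 : 0 < enorm u.
  by rewrite sqrtr_gt0 (le_lt_trans _ eu) // -expr2 sqr_ge0.
rewrite /projected_form enormZ ?ltW // !(dotZl, dotZr) !triple3 !mxE.
have d0 : dot u u - dot e u * dot e u != 0 by rewrite gt_eqF // subr_gt0.
have -> : r * (r * dot u u) - r * dot e u * (r * dot e u) =
  r * r * (dot u u - dot e u * dot e u) by ring.
by move: (dot u u - _) d0 => D d0; field; rewrite d0 !gt_eqF.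
Qed.

(** A frame U at constant angle from V has the same rate.  Its derivative dU enters
through the derivatives of the constants U . U and U . V only: they form a linear
system that determines the components of dU in the normal plane. *)
Lemma twist_form_turn (a b : R) u V dV dU : u != 0 -> dot V V = 1 -> dot V u = 0 ->
  dot V dV = 0 -> a * a + b * b = 1 -> b != 0 ->
  let U := a *: V + b *: cross ((enorm u)^-1 *: u) V in
  dot U dU = 0 -> dot dU V + dot U dV = 0 ->
  twist_form u U dU = twist_form u V dV.
Proof.
move=> u0 VV Vu VdV ab b0 U UdU dUV.
have n0 := enorm_gt0 u0; have nn := enorm_sqr u.
rewrite /twist_form; set n := enorm u in n0 nn U UdU dUV *.
have TT : dot (n^-1 *: u) (n^-1 *: u) = 1.
  by rewrite dotZl dotZr -nn; field; rewrite gt_eqF.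
have VT : dot V (n^-1 *: u) = 0 by rewrite dotZr Vu mulr0.
have [Q sQ [QT QV]] := SO3_frame TT VV VT.
have Qu : Q *m u = \col_i (n * (i == 0)%:R).
  have -> : u = n *: (n^-1 *: u) by rewrite scalerA divff ?gt_eqF // scale1r.
  by rewrite -scalemxAr QT; apply/colP => i; rewrite !mxE.
have QU : Q *m U = \col_i (a * (i == 1)%:R + b * (i == 2%:R)%:R).
  rewrite mulmxDr -!scalemxAr -(crossM _ _ sQ) QT QV.
  by apply/colP; apply: ord3P; rewrite !mxE !ord3E /=; ring.
move: VdV UdU dUV.
rewrite -(dot_SO3 V dV sQ) -(dot_SO3 U dU sQ) -(dot_SO3 dU V sQ) -(dot_SO3 U dV sQ).
rewrite -(triple_SO3 dU u U sQ) -(triple_SO3 dV u V sQ) Qu QV QU.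
move: (Q *m dV) (Q *m dU) => c d.
rewrite !triple3 !dot3 !mxE /= !(mulr0, mulr1, mul0r, mul1r, addr0, add0r, subr0, sub0r).
move: (c 0 0) (c 1 0) (c 2%:R 0) (d 0 0) (d 1 0) (d 2%:R 0).
move=> c0 c1 c2 d0 d1 d2 c10 ad db.
have {}d1E : d1 = - (b * c2) by move: db; rewrite c10; lra.
have d2E : d2 = a * c2.
  apply: (mulfI b0); move: ad; rewrite d1E; lra.
rewrite d1E d2E c10 -[in RHS](mul1r c2) -ab; field.
by rewrite gt_eqF.
Qed.

(** The numbers x and y are the coordinates of e in the basis V, T x V of the normal
plane, and dx, dy their derivatives, so the left-hand side is the rate of change
of the angle from V to the projection of e. *)
Lemma frame_comparison e u V du dV : u != 0 -> dot e e = 1 ->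
  dot e u * dot e u < dot u u -> dot V V = 1 -> dot V u = 0 ->
  dot V dV = 0 -> dot dV u + dot V du = 0 ->
  let n := enorm u in let dn := dot u du / n in
  let x := dot e V in let y := triple e u V / n in
  let dx := dot e dV in
  let dy := (triple e du V + triple e u dV) / n - triple e u V * dn / (n * n) in
  0 < x * x + y * y /\
  (x * dy - y * dx) / (x * x + y * y) = projected_form e u du - twist_form u V dV.
Proof.
move=> u0 ee eu VV Vu VdV dVu n dn x y dx dy.
have n0 : 0 < n by exact: enorm_gt0.
have nn : n * n = dot u u by exact: enorm_sqr.
have nE : n = enorm u by []; clearbody n.
have TT : dot (n^-1 *: u) (n^-1 *: u) = 1.
  by rewrite dotZl dotZr -nn; field; rewrite gt_eqF.
have VT : dot V (n^-1 *: u) = 0 by rewrite dotZr Vu mulr0.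
have [Q sQ [Qu QV]] := SO3_frame TT VV VT.
have {}Qu : Q *m u = \col_i (n * (i == 0)%:R).
  have -> : u = n *: (n^-1 *: u) by rewrite scalerA divff ?gt_eqF // scale1r.
  by rewrite -scalemxAr Qu; apply/colP => i; rewrite !mxE.
rewrite /projected_form /twist_form -nE /x /y /dx /dy /dn /x /y.
move: ee eu VdV dVu nn.
rewrite -(dot_SO3 e e sQ) -(dot_SO3 e u sQ) -(dot_SO3 u u sQ) -(dot_SO3 V dV sQ).
rewrite -(dot_SO3 dV u sQ) -(dot_SO3 V du sQ) -(dot_SO3 e V sQ) -(dot_SO3 u du sQ).
rewrite -(dot_SO3 e dV sQ) -(triple_SO3 e u V sQ) -(triple_SO3 e du V sQ).
rewrite -(triple_SO3 e u dV sQ) -(triple_SO3 du u e sQ) -(triple_SO3 dV u V sQ) Qu QV.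
(* In these coordinates u = (n, 0, 0) and V = (0, 1, 0). *)
move: (Q *m e) (Q *m du) (Q *m dV) => a b c.
rewrite !triple3 !dot3 !mxE /= !(mulr0, mulr1, mul0r, mul1r, addr0, add0r, subr0, sub0r).
move: (a 0 0) (a 1 0) (a 2%:R 0) (b 0 0) (b 1 0) (b 2%:R 0) (c 0 0) (c 1 0) (c 2%:R 0).
move=> a0 a1 a2 b0 b1 b2 c0 c1 c2 aa au c10 cb _.
have {cb} b1E : b1 = - (c0 * n) by lra.
have s0 : 0 < a1 * a1 + a2 * a2.
  have -> : a1 * a1 + a2 * a2 = 1 - a0 * a0 by lra.
  have : 0 < n * n * (1 - a0 * a0) by lra.
  by rewrite pmulr_rgt0 // mulr_gt0.
have -> : (a0 * - 0 + a1 * - 0 + a2 * n) / n = a2 by field; rewrite gt_eqF.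
have -> : n * n - a0 * n * (a0 * n) = n * n * (a1 * a1 + a2 * a2).
  have -> : a1 * a1 + a2 * a2 = 1 - a0 * a0 by lra.
  by ring.
split=> //; rewrite c10 b1E; field.
by rewrite !gt_eqF.
Qed.
End VectorAlgebra.

(** * Paths as functions on the line *)

Section PathCoordinates.
Variable R : realType.
Local Notation E := 'cV[R]_3.
Local Notation I := (set_type (@interval02 R)).
Implicit Types f g : I -> E.

Definition clampI (x : R) : I := mkI (clampR02 x).

Lemma clampI_id (x : R) : 0 <= x <= 2 -> \val (clampI x) = x.
Proof. exact: clampR_id. Qed.

Lemma clampI_continuous : continuous clampI.
Proof. by apply: continuous_comp_initial; exact: clampR_continuous. Qed.

Lemma derivableI_continuous f : derivableI f -> continuous f.
Proof.
move=> df t; apply/continuous_withinNx; have PF := I_dnbhs_proper t.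
have cdiff : diffq f t s @[s --> t^'] --> derivI f t := derivI_cvg df.
have cval : \val s - \val t @[s --> t^'] --> (0 : R).
  rewrite -(subrr (\val t)); apply: cvgB; last exact: cvg_cst.
  by apply: cvg_within_filter; exact: initial_continuous.
have cff : f t + (\val s - \val t) *: diffq f t s @[s --> t^'] --> f t + 0 *: derivI f t.
  exact: (cvgD (cvg_cst (f t)) (cvgZ cval cdiff)).
rewrite scale0r addr0 in cff; apply: cvg_trans cff; apply: near_eq_cvg.
near=> s; have st : s != t by near: s; exact: nbhs_dnbhs_neq.
rewrite /diffq scalerA divff ?scale1r ?subrKC //.
by rewrite subr_eq0; apply: contra st => /eqP/val_inj ->.
Unshelve. all: by end_near. Qed.

Lemma path_coord_continuous f i : derivableI f -> continuous (fun x => f (clampI x) i 0).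
Proof.
move=> /derivableI_continuous cf x.
have cfc : {for x, continuous (f \o clampI)}.
  by apply: continuous_comp; [exact: clampI_continuous|exact: cf].
by apply: (cvg_comp (f \o clampI) (fun v : E => v i 0) cfc); exact: coord_continuous.
Qed.

Lemma path_coord_derive f i (x : R) : derivableI f -> 0 < x < 2 ->
  is_derive x (1 : R) (fun y => f (clampI y) i 0) (derivI f (clampI x) i 0).
Proof.
move=> df /andP[x0 x2]; set t := clampI x.
have xt : \val t = x by rewrite clampI_id // !ltW.
have cdiff : diffq f t s i 0 @[s --> t^'] --> derivI f t i 0.
  by apply: (cvg_comp (diffq f t) (fun v : E => v i 0) (derivI_cvg df)); exact: coord_continuous.
have d0 : 0 < Num.min x (2 - x) by rewrite lt_min x0 subr_gt0.
have clampE (h : R) : `|h| < Num.min x (2 - x) -> \val (clampI (h + x)) = h + x.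
  rewrite lt_min !ltr_norml => /andP[/andP[? ?] /andP[? ?]].
  by rewrite clampI_id //; apply/andP; split; lra.
have cclamp : clampI (h + x) @[h --> (0 : R)^'] --> t^'.
  have ccl : clampI (h + x) @[h --> (0 : R)] --> t.
    rewrite /t -[in X in _ --> clampI X](add0r x).
    apply: (@continuous_comp _ _ _ (fun h : R => h + x) clampI 0); last exact: clampI_continuous.
    exact: (cvgD cvg_id (cvg_cst x)).
  move=> A /ccl tA.
  have {}tA : \forall h \near (0 : R)^', clampI (h + x) != t -> A (clampI (h + x)).
    by apply: cvg_within; exact: tA.
  suff : \forall h \near (0 : R)^', A (clampI (h + x)) by [].
  near=> h; have : clampI (h + x) != t -> A (clampI (h + x)) by near: h.
  apply; apply/eqP => /(congr1 \val); rewrite xt clampE.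
    have h0 : h != 0 by near: h; exact: nbhs_dnbhs_neq.
    by move=> hx; move/eqP: h0; apply; lra.
  by near: h; exact: dnbhs0_lt.
have cF := cvg_comp (fun h => clampI (h + x)) (fun s => diffq f t s i 0) cclamp cdiff.
have cv : h^-1 *: (((fun y => f (clampI y) i 0) \o shift x) (h *: (1 : R)) - f t i 0)
    @[h --> (0 : R)^'] --> derivI f t i 0.
  apply: cvg_trans cF; apply: near_eq_cvg; near=> h.
  have hE : \val (clampI (h + x)) = h + x by apply: clampE; near: h; exact: dnbhs0_lt.
  have -> : h%:A = h by exact: mulr1.
  change (diffq f t (clampI (h + x)) i 0 = h^-1 * (f (clampI (h + x)) i 0 - f t i 0)).
  by rewrite /diffq !mxE hE xt addrK.
by apply: DeriveDef; [exact: cvgP cv|exact: cvg_lim cv].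
Unshelve. all: by end_near. Qed.

End PathCoordinates.

(** * The topology of smooth convergence *)

Section SmoothMapTopology.
Variable R : realType.
Local Notation E := 'cV[R]_3.
Local Notation I := (set_type (@interval02 R)).

Definition nderivI (k : nat) (g : smooth_map R) : I -> E := iter k (@derivI R) g.

Lemma nbhs_jet_dist (f : smooth_map R) (k : nat) (e : R) : 0 < e ->
  \forall g \near f, forall t : I, `|nderivI k f t - nderivI k g t| < e.
Proof.
move=> e0.
have cj : continuous (fun g : smooth_map R => jet g k : {uniform I -> E}).
  move=> g; apply: (@continuous_comp _ _ _ (@jet R) (fun j => j k)).
    exact: initial_continuous.
  exact: (@proj_continuous nat (fun=> {uniform I -> E}) k).
have : nbhs (jet f k : {uniform I -> E})
    [set g : {uniform I -> E} | forall t : I, `|nderivI k f t - (g : I -> E) t| < e].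
  apply/uniform_nbhs; exists [set ab : E * E | ball ab.1 e ab.2]; split.
    by rewrite -entourage_ballE; exists e.
  by move=> g H t; have := H t Logic.I; rewrite /= -ball_normE.
by move/cj.
Qed.

Lemma smooth_map_continuous (T : topologicalType) (h : T -> smooth_map R) :
  (forall k (p : T) (e : R), 0 < e -> \forall q \near p,
    forall t : I, `|nderivI k (h p) t - nderivI k (h q) t| < e) ->
  continuous h.
Proof.
move=> hP; apply: continuous_comp_initial => p.
apply/cvg_sup => k.
move: p; apply: continuous_comp_initial => p.
move=> A /uniform_nbhs[U [entU UA]].
rewrite -entourage_ballE in entU; have [e /= e0 eU] := entU.
apply: filterS (hP k p e e0) => q hpq; apply: UA => t _; apply: eU => /=.
by rewrite -ball_normE; exact: hpq.
Qed.

(** Evaluation is jointly continuous because the maps converge uniformly and each of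
their derivatives is continuous. *)
Lemma nderivI_continuous k i :
  continuous (fun z : smooth_map R * R => nderivI k z.1 (clampI z.2) i 0).
Proof.
move=> [f x]; apply/cvgrPdist_lt => e e0.
have e2 : 0 < e / 2 by rewrite divr_gt0.
have Pf := nbhs_jet_dist f k e2.
have /cvgrPdist_lt/(_ _ e2) Qx := @path_coord_continuous R _ i (@smapP R f k) x.
exists ([set g | forall t : I, `|nderivI k f t - nderivI k g t| < e / 2],
  [set y | `|nderivI k f (clampI x) i 0 - nderivI k f (clampI y) i 0| < e / 2]) => //.
move=> [g y] /= [fg xy]; rewrite (splitr e).
rewrite -[X in `|X|](subrKA (nderivI k f (clampI y) i 0)).
rewrite (le_lt_trans (ler_normD _ _)) // ltrD //.
have := fg (clampI y); apply: le_lt_trans.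
set v := nderivI k f _; set w := nderivI k g _.
have -> : v i 0 - w i 0 = (v - w) i 0 by rewrite !mxE.
rewrite [leRHS]/Num.Def.normr/= mx_normrE.
exact: (@le_bigmax _ _ _ 0 (fun ij => `|(v - w) ij.1 ij.2|) (i, 0)).
Qed.

End SmoothMapTopology.

(** * The twist of a projected frame *)

Section VectorCalculus.
Variable R : realType.
Local Notation E := 'cV[R]_3.

Lemma continuous_dotf (T : topologicalType) (u v : T -> E) :
  (forall i, continuous (fun z => u z i 0)) -> (forall i, continuous (fun z => v z i 0)) ->
  continuous (fun z => dot (u z) (v z)).
Proof.
move=> cu cv; rewrite (_ : (fun z => _) = fun z => u z 0 0 * v z 0 0 + u z 1 0 * v z 1 0
  + u z 2%:R 0 * v z 2%:R 0); last by apply/funext => z; rewrite dot3.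
by continuity.
Qed.

Lemma continuous_enormf (T : topologicalType) (u : T -> E) :
  (forall i, continuous (fun z => u z i 0)) -> continuous (fun z => enorm (u z)).
Proof. by move=> cu; apply: continuous_sqrtf; exact: continuous_dotf. Qed.

Lemma continuous_triplef (T : topologicalType) (u v w : T -> E) :
  (forall i, continuous (fun z => u z i 0)) -> (forall i, continuous (fun z => v z i 0)) ->
  (forall i, continuous (fun z => w z i 0)) ->
  continuous (fun z => triple (u z) (v z) (w z)).
Proof.
move=> cu cv cw; rewrite (_ : (fun z => _) = fun z =>
  u z 0 0 * (v z 1 0 * w z 2%:R 0 - v z 2%:R 0 * w z 1 0)
  + u z 1 0 * (v z 2%:R 0 * w z 0 0 - v z 0 0 * w z 2%:R 0)
  + u z 2%:R 0 * (v z 0 0 * w z 1 0 - v z 1 0 * w z 0 0)); first by continuity.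
by apply/funext => z; rewrite triple3.
Qed.

Lemma continuous_projected_formf (T : topologicalType) (e : E) (u du : T -> E) :
  (forall i, continuous (fun z => u z i 0)) -> (forall i, continuous (fun z => du z i 0)) ->
  (forall z, dot e (u z) * dot e (u z) < dot (u z) (u z)) ->
  continuous (fun z => projected_form e (u z) (du z)).
Proof.
move=> cu cdu eu.
have ce i : continuous (fun _ : T => e i 0) by exact: continuous_cstf.
have ceu := continuous_dotf ce cu; have cuu := continuous_dotf cu cu.
have cn := continuous_enormf cu; have ct := continuous_triplef cdu cu ce.
rewrite /projected_form; continuity => z.
rewrite mulf_neq0 // gt_eqF ?subr_gt0 // sqrtr_gt0 (le_lt_trans _ (eu z)) //.
by rewrite -expr2 sqr_ge0.
Qed.

Lemma continuous_twist_formf (T : topologicalType) (u V dV : T -> E) :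
  (forall i, continuous (fun z => u z i 0)) -> (forall i, continuous (fun z => V z i 0)) ->
  (forall i, continuous (fun z => dV z i 0)) -> (forall z, u z != 0) ->
  continuous (fun z => twist_form (u z) (V z) (dV z)).
Proof.
move=> cu cV cdV u0; have ct := continuous_triplef cdV cu cV.
have cn := continuous_enormf cu.
by rewrite /twist_form; continuity => z; rewrite gt_eqF // enorm_gt0.
Qed.

Lemma is_derive_dot (u v : R -> E) (du dv : E) (x : R) :
  (forall i, is_derive x (1 : R) (fun y => u y i 0) (du i 0)) ->
  (forall i, is_derive x (1 : R) (fun y => v y i 0) (dv i 0)) ->
  is_derive x (1 : R) (fun y => dot (u y) (v y)) (dot du (v x) + dot (u x) dv).
Proof.
move=> hu hv; rewrite (_ : (fun y => _) = fun z => u z 0 0 * v z 0 0 + u z 1 0 * v z 1 0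
  + u z 2%:R 0 * v z 2%:R 0); last by apply/funext => z; rewrite dot3.
by apply: is_derive_eq; rewrite !dot3 /GRing.scale /=; ring.
Qed.

Lemma is_derive_triple (e : E) (u v : R -> E) (du dv : E) (x : R) :
  (forall i, is_derive x (1 : R) (fun y => u y i 0) (du i 0)) ->
  (forall i, is_derive x (1 : R) (fun y => v y i 0) (dv i 0)) ->
  is_derive x (1 : R) (fun y => triple e (u y) (v y)) (triple e du (v x) + triple e (u x) dv).
Proof.
move=> hu hv; rewrite (_ : (fun y => _) = fun z =>
  e 0 0 * (u z 1 0 * v z 2%:R 0 - u z 2%:R 0 * v z 1 0)
  + e 1 0 * (u z 2%:R 0 * v z 0 0 - u z 0 0 * v z 2%:R 0)
  + e 2%:R 0 * (u z 0 0 * v z 1 0 - u z 1 0 * v z 0 0)); last by apply/funext => z; rewrite triple3.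
by apply: is_derive_eq; rewrite !triple3 /GRing.scale /=; ring.
Qed.

Lemma is_derive_enorm (u : R -> E) (du : E) (x : R) : u x != 0 ->
  (forall i, is_derive x (1 : R) (fun y => u y i 0) (du i 0)) ->
  is_derive x (1 : R) (fun y => enorm (u y)) (dot (u x) du / enorm (u x)).
Proof.
move=> ux0 hu; have n0 := enorm_gt0 ux0.
have dsqrt := is_derive1_sqrt (dot_gt0 ux0).
have := is_derive1_fcomp dsqrt (is_derive_dot hu hu).
rewrite -/(enorm (u x)) => D; apply: is_derive_eq.
by rewrite (dotC du); field; rewrite gt_eqF.
Qed.

Section ProjectedFrame.
Variables (e : E) (u du V dV : R -> E).
Hypotheses (cu : forall i, continuous (fun x => u x i 0))
  (cdu : forall i, continuous (fun x => du x i 0))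
  (cV : forall i, continuous (fun x => V x i 0))
  (cdV : forall i, continuous (fun x => dV x i 0)).
Hypotheses
  (dux : forall (x : R) i, 0 < x < 2 -> is_derive x (1 : R) (fun y => u y i 0) (du x i 0))
  (dVx : forall (x : R) i, 0 < x < 2 -> is_derive x (1 : R) (fun y => V y i 0) (dV x i 0)).
Hypotheses (u0 : forall x, u x != 0) (ee : dot e e = 1)
  (eu : forall x, dot e (u x) * dot e (u x) < dot (u x) (u x))
  (VV : forall x, dot (V x) (V x) = 1) (Vu : forall x, dot (V x) (u x) = 0)
  (VdV : forall x : R, 0 < x < 2 -> dot (V x) (dV x) = 0)
  (dVu : forall x : R, 0 < x < 2 -> dot (dV x) (u x) + dot (V x) (du x) = 0).
Hypotheses (u20 : u 2 = u 0) (V20 : V 2 = V 0).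

Let n0 x : enorm (u x) != 0.
Proof. by rewrite gt_eqF // enorm_gt0. Qed.

Let cn : continuous (fun x => enorm (u x)).
Proof. exact: continuous_enormf. Qed.

Let ce i : continuous (fun _ : R => e i 0).
Proof. exact: continuous_cstf. Qed.

(** The coordinates of e in the basis V, T x V form a closed curve in the plane
minus the origin, and its angular velocity is the difference of the integrands. *)
Lemma projected_frame_winding :
  sin (integral02 (fun x => projected_form e (u x) (du x))
       - integral02 (fun x => twist_form (u x) (V x) (dV x))) = 0.
Proof.
pose dn x := dot (u x) (du x) / enorm (u x).
pose X x := dot e (V x); pose Y x := triple e (u x) (V x) / enorm (u x).
pose dX x := dot e (dV x).
pose dY x := (triple e (du x) (V x) + triple e (u x) (dV x)) / enorm (u x)
  - triple e (u x) (V x) * dn x / (enorm (u x) * enorm (u x)).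
have ceuV := continuous_triplef ce cu cV.
have cX : continuous X by exact: continuous_dotf.
have cY : continuous Y by rewrite /Y; continuity.
have cdX : continuous dX by exact: continuous_dotf.
have cdY : continuous dY.
  have c1 := continuous_triplef ce cdu cV; have c2 := continuous_triplef ce cu cdV.
  have c3 := continuous_dotf cu cdu.
  by rewrite /dY /dn; continuity => // z; rewrite mulf_neq0.
have pX : primitive02 X dX.
  split=> // x; rewrite in_itv /= => x02.
  have de i : is_derive x (1 : R) (fun _ => e i 0) ((0 : E) i 0).
    by rewrite mxE; exact: is_derive_cst.
  have := is_derive_dot de (fun i => dVx i x02).
  by rewrite (_ : dot 0 _ = 0) ?add0r // dot3 !mxE; ring.
have pY : primitive02 Y dY.
  split=> // x; rewrite in_itv /= => x02.
  have dui i := dux i x02; have dVi i := dVx i x02.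
  have D1 := is_derive_triple e dui dVi.
  have D2 := @is_derive1V _ (fun y => enorm (u y)) x _ (n0 x) (is_derive_enorm (u0 x) dui).
  have D := is_derive1M D1 D2.
  apply: is_derive_eq; rewrite /dY /dn; field; exact: n0.
have XY0 x : X x * X x + Y x * Y x != 0.
  (* Positivity at x does not involve the derivatives, so they are taken to be 0. *)
  have [] := @frame_comparison R e (u x) (V x) 0 0 (u0 x) ee (eu x) (VV x) (Vu x).
  - by rewrite dot3 !mxE; ring.
  - by rewrite !dot3 !mxE; ring.
  by move=> h _; rewrite gt_eqF.
have := closed_curve_winding pX pY cdX cdY XY0.
rewrite /X /Y u20 V20 => /(_ erefl erefl) <-; congr sin.
have cp := continuous_projected_formf cu cdu eu.
have ct := continuous_twist_formf cu cV cdV u0.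
rewrite -integral02B //; apply: eq_integral02 => [||x x02].
- by continuity.
- exact: (angular_velocity_continuous pX pY cdX cdY XY0).
have [] := frame_comparison (u0 x) ee (eu x) (VV x) (Vu x) (VdV x02) (dVu x02).
by move=> _ <-.
Qed.

End ProjectedFrame.

End VectorCalculus.

(** * The total twist of a framed path *)

Section TotalTwist.
Variable R : realType.
Local Notation E := 'cV[R]_3.
Local Notation I := (set_type (@interval02 R)).

Local Notation P := (set_type (@framed_path R)).

Definition twist_rate (p : P) (x : R) : R :=
  twist_form (derivI (curve p) (clampI x)) (frame p (clampI x)) (derivI (frame p) (clampI x)).

Definition total_twist (p : P) : R := integral02 (twist_rate p).

Lemma curve_continuous : continuous (@curve R).
Proof.
move=> p.
have cval : {for p, continuous (set_val : P -> smooth_map R * smooth_map R)}.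
  exact: initial_continuous.
have cproj : {for set_val p, continuous (@fst (smooth_map R) (smooth_map R))}.
  by move=> ?; exact: cvg_fst.
exact: (continuous_comp cval cproj).
Qed.

Lemma frame_continuous : continuous (@frame R).
Proof.
move=> p.
have cval : {for p, continuous (set_val : P -> smooth_map R * smooth_map R)}.
  exact: initial_continuous.
have cproj : {for set_val p, continuous (@snd (smooth_map R) (smooth_map R))}.
  by move=> ?; exact: cvg_snd.
exact: (continuous_comp cval cproj).
Qed.

Lemma nderivI_curry_continuous (T : topologicalType) (h : T -> smooth_map R) k i :
  continuous h -> continuous (fun z : T * R => nderivI k (h z.1) (clampI z.2) i 0).
Proof.
move=> ch z.
have cz : {for z, continuous (fun z : T * R => (h z.1, z.2))}.
  have c1 : {for z, continuous (h \o fst)}.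
    by apply: continuous_comp; [move=> ?; exact: cvg_fst|exact: ch].
  have c2 : {for z, continuous (@snd T R)} by move=> ?; exact: cvg_snd.
  exact: (cvg_pair c1 c2).
exact: (continuous_comp cz (@nderivI_continuous R k i _)).
Qed.

Lemma twist_rate_jointly_continuous :
  continuous (fun z : P * R => twist_rate z.1 z.2).
Proof.
apply: continuous_twist_formf => [i|i|i|[p x]].
- exact: (@nderivI_curry_continuous _ _ 1 i curve_continuous).
- exact: (@nderivI_curry_continuous _ _ 0 i frame_continuous).
- exact: (@nderivI_curry_continuous _ _ 1 i frame_continuous).
by have [imm _ _] := framed_pathP p; exact: imm.
Qed.

Lemma total_twist_continuous : continuous total_twist.
Proof. exact/integral02_parameter_continuous/twist_rate_jointly_continuous. Qed.

Lemma twist_rate_continuous p : continuous (twist_rate p).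
Proof.
move=> x; have cx : {for x, continuous (fun y : R => (p, y))}.
  exact: (cvg_pair (cvg_cst p) cvg_id).
exact: (continuous_comp cx (@twist_rate_jointly_continuous _)).
Qed.

Lemma dot_const_derivI (f g : I -> E) (c x : R) : derivableI f -> derivableI g ->
  (forall t, dot (f t) (g t) = c) -> 0 < x < 2 ->
  dot (derivI f (clampI x)) (g (clampI x)) + dot (f (clampI x)) (derivI g (clampI x)) = 0.
Proof.
move=> df dg fg x02.
have D := is_derive_dot (fun i => path_coord_derive i df x02) (fun i => path_coord_derive i dg x02).
rewrite (_ : (fun y => _) = cst c) in D; last by apply/funext => y; exact: fg.
have [_ <-] := D; exact: derive_cst.
Qed.

Lemma frame_derivI (p : P) (x : R) : 0 < x < 2 ->
  let t := clampI x in
  dot (frame p t) (derivI (frame p) t) = 0 /\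
  dot (derivI (frame p) t) (derivI (curve p) t)
    + dot (frame p t) (derivI (derivI (curve p)) t) = 0.
Proof.
move=> x02 t; have [imm nV pV] := framed_pathP p.
have dV := @smap_derivable R (frame p); split; last first.
  exact: (dot_const_derivI dV (@smapP R (curve p) 1) pV).
have VV s : dot (frame p s) (frame p s) = 1 by rewrite -enorm_sqr nV mulr1.
have := dot_const_derivI dV dV VV x02; rewrite dotC -/t; lra.
Qed.

Lemma mulmx_derivI (A : 'M[R]_3) (f : I -> E) : derivableI f ->
  derivableI (fun s => A *m f s) /\ forall t, derivI (fun s => A *m f s) t = A *m derivI f t.
Proof.
move=> df; have AfE s : A *m f s = 1 *: (A *m f s) + 0 by rewrite scale1r addr0.
split=> t; last by rewrite (derivI_affine df AfE) scale1r.
rewrite (diffq_affine t AfE) scale1r; have PF := I_dnbhs_proper t.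
exact: (cvgP _ (@cvg_mulmx R A _ _ _ _ _ (derivI_cvg df))).
Qed.

(** When sin (2 theta) = 0 the new frame is V or - V up to the rotation A; otherwise
twist_form_turn applies, with the two linear relations on the derivative of the
new frame obtained by differentiating its products with itself and with V. *)
Lemma total_twist_similar (p q : P) : framed_similar p q ->
  total_twist p = total_twist q.
Proof.
move=> [A [r [theta [c [sA r0 pq Vq]]]]].
apply: eq_integral02 => [||x x02]; [exact: twist_rate_continuous..|].
have [imm nV pV] := framed_pathP p; have [immq nVq pVq] := framed_pathP q.
have VV s : dot (frame p s) (frame p s) = 1 by rewrite -enorm_sqr nV mulr1.
rewrite /twist_rate; set t := clampI x.
rewrite (framed_similar_derivI pq) twist_formZ //; last first.
  by move: (immq t); rewrite (framed_similar_derivI pq); apply: contra => /eqP ->; rewrite scaler0.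
set a := cos (2 * theta) in Vq *; set b := sin (2 * theta) in Vq *.
have ab : a * a + b * b = 1 by rewrite -(cos2Dsin2 (2 * theta)) !expr2.
have [VdV _] := frame_derivI p x02; rewrite -/t in VdV.
have AA : A *m A^T = 1%:M by case: sA.
have [b0|b0] := eqVneq b 0.
  have VqE s : frame q s = a *: (A *m frame p s) + 0.
    by rewrite Vq /twist -/a -/b b0 scale0r !addr0 scalemxAr.
  rewrite (derivI_affine (@smap_derivable _ (frame p)) VqE) VqE addr0.
  have a2 : a * a = 1 by move: ab; rewrite b0 mul0r addr0.
  rewrite !scalemxAr twist_formM // /twist_form; congr (_ / _).
  by rewrite tripleZ a2 mul1r.
pose dU := A^T *m derivI (frame q) t.
have dVqE : derivI (frame q) t = A *m dU by rewrite /dU mulmxA AA mul1mx.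
rewrite dVqE Vq twist_formM // /twist -/a -/b /conormal.
rewrite (twist_form_turn (imm t) (VV t) (pV t) VdV ab b0) //.
  by have [VdVq _] := frame_derivI q x02; rewrite -/t dVqE Vq dot_SO3 in VdVq.
have [dg dgE] := mulmx_derivI A^T (@smap_derivable R (frame q)).
have gV s : dot (A^T *m frame q s) (frame p s) = a.
  rewrite Vq mulmxA SO3_trmxM // mul1mx /twist /conormal -/a -/b.
  transitivity (a * dot (frame p s) (frame p s)); last by rewrite VV mulr1.
  by rewrite !dot3 !mxE !ord3E; ring.
have := dot_const_derivI dg (@smap_derivable R (frame p)) gV x02.
by rewrite dgE -/t -/dU Vq mulmxA SO3_trmxM // mul1mx.
Qed.
End TotalTwist.

(** * The total twist on the moduli space *)

Section TwistOnModuli.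
Variable R : realType.
Local Notation E := 'cV[R]_3.
Local Notation I := (set_type (@interval02 R)).
Local Notation P := (set_type (@framed_path R)).

Definition moduli_twist (m : spaceM R) : R := total_twist (repr (\val (repr m))).

Lemma moduli_twist_continuous : continuous moduli_twist.
Proof.
have cO : continuous ((@total_twist R) \o repr : spaceO R -> R).
  apply: repr_comp_continuous; first exact: total_twist_continuous.
  move=> p q /eqP/eqmodP/asboolP pq; apply/eqP.
  exact/total_twist_similar/translated_similar.
have cC : continuous (fun x : @spaceC R => total_twist (repr (\val x))).
  move=> x; have cval : {for x, continuous (set_val : @spaceC R -> spaceO R)}.
    exact: initial_continuous.
  exact: (continuous_comp cval (cO _)).
apply: (repr_comp_continuous cC) => x y /eqP/eqmodP/asboolP xy.
by apply/eqP; exact: total_twist_similar.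
Qed.

Definition projected_rate (e : E) (f : smooth_map R) (x : R) : R :=
  projected_form e (derivI f (clampI x)) (derivI (derivI f) (clampI x)).

Lemma smooth_circle_ends (f : I -> E) : smooth_circle f -> f (clampI 2) = f (clampI 0).
Proof.
move=> [g [_ gp fg]]; rewrite !fg !clampI_id ?lexx ?ler0n //.
by rewrite -(gp 0) add0r.
Qed.

Lemma projected_twist (p : P) (e : E) : framed_loop p -> dot e e = 1 ->
  (forall t, dot e (derivI (curve p) t) * dot e (derivI (curve p) t)
    < dot (derivI (curve p) t) (derivI (curve p) t)) ->
  sin (integral02 (projected_rate e (curve p)) - total_twist p) = 0.
Proof.
move=> [lcp lp _] ee eu; have [imm nV pV] := framed_pathP p.
have VV s : dot (frame p s) (frame p s) = 1 by rewrite -enorm_sqr nV mulr1.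
apply: projected_frame_winding => //.
- by move=> i; exact: (path_coord_continuous (@smapP R (curve p) 1)).
- by move=> i; exact: (path_coord_continuous (@smapP R (curve p) 2)).
- by move=> i; exact: (path_coord_continuous (@smapP R (frame p) 0)).
- by move=> i; exact: (path_coord_continuous (@smapP R (frame p) 1)).
- by move=> x i x02; exact: (path_coord_derive i (@smapP R (curve p) 1) x02).
- by move=> x i x02; exact: (path_coord_derive i (@smapP R (frame p) 0) x02).
- by move=> x x02; have [] := frame_derivI p x02.
- by move=> x x02; have [] := frame_derivI p x02.
- exact: smooth_circle_ends.
- exact: smooth_circle_ends.
Qed.

(** The loop of a representative of m is only similar to f; the rotation that relates
them is moved from the loop to the vector e. *)
Lemma moduli_twist_projected (m : spaceM R) (f : @immersed_loop R) (e : E) :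
  forget m = \pi_(spaceB R) f -> dot e e = 1 ->
  (forall t, dot e (derivI (\val f) t) * dot e (derivI (\val f) t)
    < dot (derivI (\val f) t) (derivI (\val f) t)) ->
  sin (integral02 (projected_rate e (\val f)) - moduli_twist m) = 0.
Proof.
move=> mf ee eu; rewrite /moduli_twist.
have lp := repr_framed_loop (repr m); set p := repr _ in lp *.
have [A [r [c [sA r0 fp]]]] : Defs.similar (loop_of lp) f.
  by move: mf => /eqmodP/asboolP.
have e'E : e = A *m (A^T *m e) by rewrite mulmxA (proj1 sA) mul1mx.
have dfE t : derivI (\val f) t = r *: (A *m derivI (curve p) t).
  exact: (derivI_affine (@smap_derivable R (curve p)) fp).
have ddfE t : derivI (derivI (\val f)) t = r *: (A *m derivI (derivI (curve p)) t).
  have dfE0 s : derivI (\val f) s = r *: (A *m derivI (curve p) s) + 0 by rewrite addr0.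
  exact: (derivI_affine (@smapP R (curve p) 1) dfE0).
have eu' t : dot (A^T *m e) (derivI (curve p) t) * dot (A^T *m e) (derivI (curve p) t)
    < dot (derivI (curve p) t) (derivI (curve p) t).
  have := eu t; rewrite dfE {1 2}e'E !dotZr !dotZl !dot_SO3 //.
  set a := dot _ _; set b := dot _ _.
  by rewrite -subr_gt0 (_ : _ - _ = r * r * (b - a * a)) ?pmulr_rgt0 ?mulr_gt0 ?subr_gt0 //; ring.
have ee' : dot (A^T *m e) (A^T *m e) = 1 by rewrite dot_SO3 //; exact: SO3_tr.
have -> : projected_rate e (\val f) = projected_rate (A^T *m e) (curve p).
  apply/funext => x; rewrite /projected_rate dfE ddfE projected_formZ //.
    by rewrite [in LHS]e'E projected_formM.
  by rewrite {1 2}e'E !dot_SO3.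
exact: projected_twist.
Qed.

End TwistOnModuli.

(** * Paths that are restrictions of smooth functions *)

Section Restriction.
Variable R : realType.
Local Notation E := 'cV[R]_3.
Local Notation I := (set_type (@interval02 R)).

Lemma restriction_derivI (g dg : R -> E) : (forall x, is_derive x (1 : R) g (dg x)) ->
  forall t : I, diffq (fun s : I => g (\val s)) t s @[s --> t^'] --> dg (\val t).
Proof.
move=> dgx t; apply/diffq_cvgP => e e0; set x := \val t.
have [dgt dgE] := dgx x.
have : h^-1 *: ((g \o shift x) (h *: (1 : R)) - g x) @[h --> (0 : R)^'] --> dg x.
  by rewrite -dgE; exact: dgt.
move=> /cvgrPdist_lt/(_ _ e0)/nbhs_ballP[d d0 gd]; exists d => // s st sd.
have st0 : \val s - x != 0.
  by rewrite subr_eq0; apply: contra st => /eqP/val_inj ->.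
have := gd (\val s - x); rewrite /ball /= sub0r normrN => /(_ sd st0).
by rewrite (_ : (_ - x)%:A = \val s - x) ?subrK //; exact: mulr1.
Qed.

Lemma iter_restriction_derivI (g : nat -> R -> E) :
  (forall k x, is_derive x (1 : R) (g k) (g k.+1 x)) ->
  forall k, iter k (@derivI R) (fun s : I => g 0 (\val s)) = fun s : I => g k (\val s).
Proof.
move=> dg; elim=> [//|k IH]; rewrite iterS IH; apply/funext => t.
by apply: derivI_eq; exact: restriction_derivI.
Qed.

Lemma restriction_smoothI (g : nat -> R -> E) :
  (forall k x, is_derive x (1 : R) (g k) (g k.+1 x)) ->
  smoothI (fun s : I => g 0 (\val s)).
Proof.
move=> dg k; rewrite iter_restriction_derivI // => t.
exact: cvgP (restriction_derivI (dg k) (t := t)).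
Qed.

Lemma derive1n_jet (g : nat -> R -> E) :
  (forall k x, is_derive x (1 : R) (g k) (g k.+1 x)) ->
  forall k, derive1n k (g 0) = g k.
Proof.
move=> dg; elim=> [//|k IH]; rewrite /derive1n iterS.
rewrite -/(derive1n k (g 0)) IH; apply/funext => x; rewrite derive1E.
by have [] := dg k x.
Qed.

Lemma is_derive_colP (g : R -> E) (dg : E) (x : R) :
  (forall i, is_derive x (1 : R) (fun y => g y i 0) (dg i 0)) -> is_derive x (1 : R) g dg.
Proof.
move=> dgi; have dgx : derivable g x 1.
  by apply/derivable_mxP => i j; rewrite ord1; have [] := dgi i.
apply: DeriveDef => //; rewrite derive_mx //; apply/colP => i; rewrite mxE.
by have [] := dgi i.
Qed.

End Restriction.

(** * A family of trigonometric loops *)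

Section TrigonometricLoops.
Variable R : realType.
Local Notation E := 'cV[R]_3.
Local Notation I := (set_type (@interval02 R)).

(** The k-th derivative of cos (w x), written as a shift of phase. *)
Definition cos_jet (w : R) (k : nat) (x : R) : R := w ^+ k * cos (w * x + k%:R * (pi / 2)).

(** The k-th derivative of sin (w x). *)
Definition sin_jet (w : R) (k : nat) (x : R) : R := w ^+ k * sin (w * x + k%:R * (pi / 2)).

Lemma is_derive_cos_jet w k x : is_derive x (1 : R) (cos_jet w k) (cos_jet w k.+1 x).
Proof.
rewrite /cos_jet; apply: is_derive_eq.
have -> : w * x + k.+1%:R * (pi / 2) = w * x + k%:R * (pi / 2) + pi / 2.
  by rewrite -natr1; ring.
by rewrite cosDpihalf exprS /GRing.scale /=; ring.
Qed.

Lemma is_derive_sin_jet w k x : is_derive x (1 : R) (sin_jet w k) (sin_jet w k.+1 x).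
Proof.
rewrite /sin_jet; apply: is_derive_eq.
have -> : w * x + k.+1%:R * (pi / 2) = w * x + k%:R * (pi / 2) + pi / 2.
  by rewrite -natr1; ring.
by rewrite sinDpihalf exprS /GRing.scale /=; ring.
Qed.

Definition loop_jet (a b : R) (k : nat) (x : R) : E :=
  \col_i (if i == 0 then cos_jet pi k x
          else if i == 1 then a * sin_jet pi k x else b * sin_jet (2 * pi) k x).

Lemma is_derive_loop_coord a b k i x :
  is_derive x (1 : R) (fun y => loop_jet a b k y i 0) (loop_jet a b k.+1 x i 0).
Proof.
move: i; apply: ord3P; rewrite mxE /=.
- rewrite (_ : (fun y => _) = cos_jet pi k); first exact: is_derive_cos_jet.
  by apply/funext => y; rewrite mxE.
- rewrite (_ : (fun y => _) = fun y => a * sin_jet pi k y); last by apply/funext => y; rewrite mxE.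
  have d := is_derive_sin_jet pi k x.
  by apply: is_derive_eq; rewrite /GRing.scale /=; ring.
- rewrite (_ : (fun y => _) = fun y => b * sin_jet (2 * pi) k y); last first.
    by apply/funext => y; rewrite mxE.
  have d := is_derive_sin_jet (2 * pi) k x.
  by apply: is_derive_eq; rewrite /GRing.scale /=; ring.
Qed.

Lemma is_derive_loop_jet a b k x : is_derive x (1 : R) (loop_jet a b k) (loop_jet a b k.+1 x).
Proof. by apply: is_derive_colP => i; exact: is_derive_loop_coord. Qed.

Definition trig_loop (a b : R) : smooth_map R :=
  SmoothMap (restriction_smoothI (is_derive_loop_jet a b)).

Lemma nderivI_trig_loop a b k t : nderivI k (trig_loop a b) t = loop_jet a b k (\val t).
Proof. by rewrite /nderivI (iter_restriction_derivI (is_derive_loop_jet a b)). Qed.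

Lemma loop_jet1 a b x : loop_jet a b 1 x =
  \col_i (if i == 0 then - pi * sin (pi * x)
          else if i == 1 then a * (pi * cos (pi * x)) else b * (2 * pi * cos (2 * (pi * x)))).
Proof.
apply/colP => i; rewrite !mxE /cos_jet /sin_jet !mul1r !expr1 cosDpihalf !sinDpihalf.
by rewrite mulrN mulNr (mulrA 2 pi x).
Qed.

Lemma loop_jet2 a b x : loop_jet a b 2 x =
  \col_i (if i == 0 then - pi ^+ 2 * cos (pi * x)
          else if i == 1 then - a * (pi ^+ 2 * sin (pi * x))
          else - b * ((2 * pi) ^+ 2 * sin (2 * (pi * x)))).
Proof.
apply/colP => i; rewrite !mxE /cos_jet /sin_jet.
rewrite (_ : 2 * (pi / 2) = pi); last by rewrite mulrC divfK.
rewrite (mulrA 2 pi x) cosDpi !sinDpi.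
by case: ifP => _; [|case: ifP => _]; ring.
Qed.

Lemma trig_loop_circle a b : smooth_circle (trig_loop a b).
Proof.
exists (loop_jet a b 0); split=> // [k x|x].
  rewrite (derive1n_jet (is_derive_loop_jet a b)).
  by have [] := is_derive_loop_jet a b k x.
apply/colP => i; rewrite !mxE /cos_jet /sin_jet !mul0r !addr0 !mul1r.
rewrite (_ : pi * (x + 2) = pi * x + pi *+ 2); last by rewrite -mulr_natr; ring.
rewrite (_ : 2 * pi * (x + 2) = 2 * pi * x + pi *+ 2 + pi *+ 2); last by rewrite -mulr_natr; ring.
by rewrite cosD2pi !sinD2pi.
Qed.

Lemma trig_loop_continuous (T : topologicalType) (a b : T -> R) :
  continuous a -> continuous b -> continuous (fun q => trig_loop (a q) (b q)).
Proof.
move=> ca cb; apply: smooth_map_continuous => k p e e0.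
have pos (w : R) : 0 < w -> 0 < w ^+ k by move=> w0; rewrite exprn_gt0.
have [p1 p2] : 0 < (pi : R) ^+ k /\ 0 < (2 * pi : R) ^+ k.
  by split; apply: pos; rewrite ?mulr_gt0 ?pi_gt0.
have ea : 0 < e / pi ^+ k by rewrite divr_gt0.
have eb : 0 < e / (2 * pi) ^+ k by rewrite divr_gt0.
have /cvgrPdist_lt/(_ _ ea) na := ca p; have /cvgrPdist_lt/(_ _ eb) nb := cb p.
near=> q.
have aq : `|a p - a q| < e / pi ^+ k by near: q.
have bq : `|b p - b q| < e / (2 * pi) ^+ k by near: q.
move=> t; rewrite !nderivI_trig_loop [ltLHS]/Num.Def.normr /= mx_normrE.
apply: bigmax_lt => //= -[i j] _ /=; rewrite ord1 {j}.
have sinb (w c d x : R) : 0 < w ^+ k -> `|c - d| < e / w ^+ k ->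
    `|c * sin_jet w k x - d * sin_jet w k x| < e.
  move=> w0 cd; rewrite -mulrBl normrM; apply: le_lt_trans (_ : `|c - d| * w ^+ k < _).
    rewrite ler_wpM2l // normrM (gtr0_norm w0) ler_piMr ?sin_max //.
    exact: ltW.
  by rewrite -ltr_pdivlMr.
move: i; apply: ord3P; rewrite !mxE /=.
- by rewrite subrr normr0.
- exact: sinb.
- exact: sinb.
Unshelve. all: by end_near. Qed.

Definition axis (j : 'I_3) : E := \col_i (i == j)%:R.

Lemma dot_axis j : dot (axis j) (axis j) = 1.
Proof. by move: j; apply: ord3P; rewrite dot3 !mxE /=; ring. Qed.

Lemma derivI_trig_loop a b t : derivI (trig_loop a b) t = loop_jet a b 1 (\val t).
Proof. exact: (nderivI_trig_loop a b 1). Qed.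

Lemma derivI2_trig_loop a b t : derivI (derivI (trig_loop a b)) t = loop_jet a b 2 (\val t).
Proof. exact: (nderivI_trig_loop a b 2). Qed.

Lemma cos_double (x : R) : cos (2 * x) = cos x * cos x - sin x * sin x.
Proof. by rewrite (_ : 2 * x = x + x) ?cosD //; ring. Qed.

Lemma sqr_cosDsin (x : R) : cos x * cos x + sin x * sin x = 1.
Proof. by rewrite -!expr2 cos2Dsin2. Qed.

(** The velocity could only lie along axis 1 where sin (pi x) = 0, and there
cos (2 pi x) = 1. *)
Lemma transverse_axis1 a b x : b != 0 ->
  dot (axis 1) (loop_jet a b 1 x) * dot (axis 1) (loop_jet a b 1 x)
    < dot (loop_jet a b 1 x) (loop_jet a b 1 x).
Proof.
move=> b0; rewrite -subr_gt0 loop_jet1 !dot3 !mxE /= cos_double.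
have cs := sqr_cosDsin (pi * x); move: (cos _) (sin _) cs => c s cs.
have pi0 := pi_gt0 R; move: (pi : R) pi0 => p p0.
have -> : - p * s * (- p * s) + a * (p * c) * (a * (p * c)) +
  b * (2 * p * (c * c - s * s)) * (b * (2 * p * (c * c - s * s))) -
  (0 * (- p * s) + 1 * (a * (p * c)) + 0 * (b * (2 * p * (c * c - s * s)))) *
  (0 * (- p * s) + 1 * (a * (p * c)) + 0 * (b * (2 * p * (c * c - s * s))))
  = p ^+ 2 * (s ^+ 2 + 4 * b ^+ 2 * (c * c - s * s) ^+ 2) by ring.
rewrite mulr_gt0 ?exprn_gt0 //.
have [s0|s0] := eqVneq s 0.
  have cc : c * c = 1 by move: cs; rewrite s0; lra.
  rewrite s0 cc; have : 0 < b ^+ 2 by rewrite exprn_even_gt0.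
  by lra.
by rewrite ltr_wpDr ?exprn_even_gt0 // mulr_ge0 ?sqr_ge0 // mulr_ge0 ?sqr_ge0.
Qed.

Lemma transverse_axis2 a b x : a != 0 ->
  dot (axis 2%:R) (loop_jet a b 1 x) * dot (axis 2%:R) (loop_jet a b 1 x)
    < dot (loop_jet a b 1 x) (loop_jet a b 1 x).
Proof.
move=> a0; rewrite -subr_gt0 loop_jet1 !dot3 !mxE /=.
have cs := sqr_cosDsin (pi * x); move: (cos (pi * x)) (sin _) cs => c s cs.
have pi0 := pi_gt0 R; move: (pi : R) (cos _) pi0 => p d p0.
have -> : - p * s * (- p * s) + a * (p * c) * (a * (p * c)) +
  b * (2 * p * d) * (b * (2 * p * d)) -
  (0 * (- p * s) + 0 * (a * (p * c)) + 1 * (b * (2 * p * d))) *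
  (0 * (- p * s) + 0 * (a * (p * c)) + 1 * (b * (2 * p * d)))
  = p ^+ 2 * (s ^+ 2 + a ^+ 2 * c ^+ 2) by ring.
rewrite mulr_gt0 ?exprn_gt0 //.
have [s0|s0] := eqVneq s 0.
  have cc : c ^+ 2 = 1 by move: cs; rewrite s0; lra.
  by rewrite s0 cc expr0n /= add0r mulr1 exprn_even_gt0.
by rewrite ltr_wpDr ?exprn_even_gt0 // mulr_ge0 ?sqr_ge0.
Qed.

Lemma trig_loop_immersed a b : (a != 0) || (b != 0) -> @immersed_loop R (trig_loop a b).
Proof.
move=> ab; split; first exact: trig_loop_circle.
move=> t; rewrite derivI_trig_loop; apply/eqP => v0.
case/orP: ab => [/transverse_axis2|/transverse_axis1].
  by move/(_ b (\val t)); rewrite v0 !dot3 !mxE !(mulr0, addr0) ltxx.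
by move/(_ a (\val t)); rewrite v0 !dot3 !mxE !(mulr0, addr0) ltxx.
Qed.

Definition immersed_trig_loop (a b : R) (ab : (a != 0) || (b != 0)) : @immersed_loop R :=
  exist _ (trig_loop a b) (mem_set (trig_loop_immersed ab)).

Definition loop_form (j : 'I_3) (a b x : R) : R :=
  projected_form (axis j) (loop_jet a b 1 x) (loop_jet a b 2 x).

Lemma loop_jet_continuous (T : topologicalType) (a b x : T -> R) k i :
  continuous a -> continuous b -> continuous x ->
  continuous (fun z => loop_jet (a z) (b z) k (x z) i 0).
Proof.
move=> ca cb cx; move: i; apply: ord3P.
- rewrite (_ : (fun z => _) = fun z => pi ^+ k * cos (pi * x z + k%:R * (pi / 2))).
    by continuity.
  by apply/funext => z; rewrite mxE.
- rewrite (_ : (fun z => _) = fun z => a z * (pi ^+ k * sin (pi * x z + k%:R * (pi / 2)))).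
    by continuity.
  by apply/funext => z; rewrite mxE.
- rewrite (_ : (fun z => _) = fun z =>
      b z * ((2 * pi) ^+ k * sin (2 * pi * x z + k%:R * (pi / 2)))).
    by continuity.
  by apply/funext => z; rewrite mxE.
Qed.

End TrigonometricLoops.

(** * The twist of the projected axes along the family *)

Section TwistOfTrigLoops.
Variable R : realType.
Local Notation E := 'cV[R]_3.

Definition transverse (j : 'I_3) (a b : R) : Prop :=
  forall x, dot (axis R j) (loop_jet a b 1 x) * dot (axis R j) (loop_jet a b 1 x)
    < dot (loop_jet a b 1 x) (loop_jet a b 1 x).

Lemma loop_form_continuous (T : topologicalType) j (a b x : T -> R) :
  (forall z, transverse j (a z) (b z)) -> continuous a -> continuous b -> continuous x ->
  continuous (fun z => loop_form j (a z) (b z) (x z)).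
Proof.
move=> nd ca cb cx; apply: continuous_projected_formf => [i|i|z].
- exact: loop_jet_continuous.
- exact: loop_jet_continuous.
- exact: nd.
Qed.

Lemma loop_form_continuous1 j (a b : R) : transverse j a b -> continuous (loop_form j a b).
Proof.
move=> nd; apply: (@loop_form_continuous R j (fun=> a) (fun=> b) (fun x => x)) => //.
- exact: continuous_cstf.
- exact: continuous_cstf.
- exact: continuous_idf.
Qed.

Definition loop_integral (j : 'I_3) (a b : R) : R := integral02 (loop_form j a b).

Lemma loop_integralE j a b : transverse j a b ->
  integral02 (projected_rate (axis R j) (trig_loop a b)) = loop_integral j a b.
Proof.
move=> nd.
have E x : projected_rate (axis R j) (trig_loop a b) x = loop_form j a b (clampR x).
  by rewrite /projected_rate derivI_trig_loop derivI2_trig_loop.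
rewrite (_ : projected_rate _ _ = fun x => loop_form j a b (clampR x)); last exact/funext.
apply: eq_integral02.
- exact: (continuous_compf (loop_form_continuous1 nd) (@clampR_continuous R)).
- exact: loop_form_continuous1.
- by move=> t /andP[t0 t2]; rewrite clampR_id // !ltW.
Qed.

Lemma loop_integral_continuous j (a b : R -> R) : (forall z, transverse j (a z) (b z)) ->
  continuous a -> continuous b -> continuous (fun s => loop_integral j (a s) (b s)).
Proof.
move=> nd ca cb; apply: integral02_parameter_continuous.
apply: loop_form_continuous.
- by move=> z; exact: nd.
- by apply: (continuous_compf ca) => z; exact: cvg_fst.
- by apply: (continuous_compf cb) => z; exact: cvg_fst.
- by move=> z; exact: cvg_snd.
Qed.

Definition mirror (j : 'I_3) (u : E) : E := \col_i (if i == j then - u i 0 else u i 0).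

(** A reflection fixes the scalar products and reverses the triple products; the
projected axis itself is also reversed, which does not affect its rotation. *)
Lemma projected_form_mirror j u du :
  projected_form (axis R j) (mirror j u) (mirror j du) = - projected_form (axis R j) u du.
Proof.
have uu : dot (mirror j u) (mirror j u) = dot u u.
  by move: j; apply: ord3P; rewrite !dot3 !mxE /=; ring.
have eu : dot (axis R j) (mirror j u) = - dot (axis R j) u.
  by move: j {uu}; apply: ord3P; rewrite !dot3 !mxE /=; ring.
have det : triple (mirror j du) (mirror j u) (axis R j) = triple du u (axis R j).
  by move: j {uu eu}; apply: ord3P; rewrite !triple3 !mxE /=; ring.
by rewrite /projected_form /enorm uu eu det !mulNr mulrN !opprK.
Qed.

Lemma loop_integral_mirror1 a b : transverse 1 a b ->
  loop_integral 1 (- a) b = - loop_integral 1 a b.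
Proof.
move=> nd; rewrite /loop_integral -integral02N; last exact: loop_form_continuous1.
congr integral02; apply/funext => x; rewrite /loop_form -projected_form_mirror.
by congr projected_form; apply/colP; apply: ord3P; rewrite !mxE //= mulNr.
Qed.

Lemma loop_integral_mirror2 a b : transverse 2%:R a b ->
  loop_integral 2%:R a (- b) = - loop_integral 2%:R a b.
Proof.
move=> nd; rewrite /loop_integral -integral02N; last exact: loop_form_continuous1.
congr integral02; apply/funext => x; rewrite /loop_form -projected_form_mirror.
by congr projected_form; apply/colP; apply: ord3P; rewrite !mxE //= mulNr.
Qed.

(** Up to sign and a factor u . u, the numbers x and y are the scalar product of the
projections of axes 1 and 2 to the plane normal to u and the determinant of
these projections, so the point (x, y) turns with the angle between them. *)
Lemma projected_form_difference (u du : E) :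
  dot (axis R 1) u * dot (axis R 1) u < dot u u ->
  dot (axis R 2%:R) u * dot (axis R 2%:R) u < dot u u ->
  let n := enorm u in
  let x := u 1 0 * u 2%:R 0 in let dx := u 1 0 * du 2%:R 0 + u 2%:R 0 * du 1 0 in
  let y := n * u 0 0 in let dy := n * du 0 0 + u 0 0 * (dot u du / n) in
  0 < x * x + y * y /\
  (x * dy - y * dx) / (x * x + y * y)
    = projected_form (axis R 1) u du - projected_form (axis R 2%:R) u du.
Proof.
move=> eu1 eu2 n x dx y dy.
have n0 : 0 < n by rewrite sqrtr_gt0 (le_lt_trans _ eu1) // -expr2 sqr_ge0.
have nn : n * n = dot u u by exact: enorm_sqr.
rewrite /projected_form -/n /x /dx /y /dy {x dx y dy}; move: n n0 nn => n n0.
move: eu1 eu2; rewrite !triple3 !dot3 !mxE /=.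
move: (u 0 0) (u 1 0) (u 2%:R 0) (du 0 0) (du 1 0) (du 2%:R 0) => u0 u1 u2 d0 d1 d2.
rewrite !(mul0r, mul1r, add0r, addr0, mulr0, mulr1, subr0, sub0r) => eu1 eu2 nn.
have B0 : 0 < u0 * u0 + u1 * u1 by lra.
have A0 : 0 < u0 * u0 + u2 * u2 by lra.
have DE : u1 * u2 * (u1 * u2) + n * u0 * (n * u0) = (u0 * u0 + u2 * u2) * (u0 * u0 + u1 * u1).
  rewrite (_ : n * u0 * (n * u0) = n * n * (u0 * u0)); last by ring.
  by rewrite nn; ring.
have NE : u1 * u2 * (n * d0 + u0 * ((u0 * d0 + u1 * d1 + u2 * d2) / n))
    - n * u0 * (u1 * d2 + u2 * d1) =
  ((u0 * u0 + u1 * u1) * (u1 * (d0 * u2 - d2 * u0))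
    + (u0 * u0 + u2 * u2) * (u2 * (d0 * u1 - d1 * u0))) / n.
  transitivity ((n * n * (u1 * u2 * d0 - u0 * (u1 * d2 + u2 * d1))
    + u1 * u2 * u0 * (u0 * d0 + u1 * d1 + u2 * d2)) / n).
    by field; rewrite gt_eqF.
  by rewrite nn; congr (_ / _); ring.
rewrite DE NE; split; first by rewrite mulr_gt0.
rewrite (_ : u0 * u0 + u1 * u1 + u2 * u2 - u1 * u1 = u0 * u0 + u2 * u2); last by ring.
rewrite (_ : u0 * u0 + u1 * u1 + u2 * u2 - u2 * u2 = u0 * u0 + u1 * u1); last by ring.
move: (u0 * u0 + u1 * u1) (u0 * u0 + u2 * u2) A0 B0 => B A A0 B0.
by field; rewrite !gt_eqF.
Qed.

Lemma loop_jet_half_turn (x : R) :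
  let u := loop_jet 1 1 1 x in let du := loop_jet 1 1 2 x in
  let u' := loop_jet 1 1 1 (x + 1) in let du' := loop_jet 1 1 2 (x + 1) in
  [/\ u' = \col_i (if i == 2%:R then u i 0 else - u i 0) &
      du' = \col_i (if i == 2%:R then du i 0 else - du i 0)].
Proof.
move=> u du u' du'; rewrite /u /du /u' /du' !loop_jet1 !loop_jet2.
rewrite (_ : pi * (x + 1) = pi * x + pi); last by ring.
rewrite (_ : 2 * (pi * x + pi) = 2 * (pi * x) + pi *+ 2); last by rewrite -mulr_natr; ring.
rewrite cosDpi sinDpi cosD2pi sinD2pi.
by split; apply/colP; apply: ord3P; rewrite !mxE //=; ring.
Qed.

(** The half turn t -> t + 1 reverses the components 0 and 1 of the velocity and keeps
component 2, so the plane curve of projected_form_difference is odd under it. *)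
Lemma loop_integral_neq : loop_integral 1 1 1 != loop_integral 2%:R 1 1.
Proof.
have nd1 : transverse 1 1 1 by move=> x; exact/transverse_axis1/oner_neq0.
have nd2 : transverse 2%:R 1 1 by move=> x; exact/transverse_axis2/oner_neq0.
pose u := loop_jet 1 1 1 : R -> E; pose du := loop_jet 1 1 2 : R -> E.
pose n x := enorm (u x).
pose X x := u x 1 0 * u x 2%:R 0.
pose dX x := u x 1 0 * du x 2%:R 0 + u x 2%:R 0 * du x 1 0.
pose Y x := n x * u x 0 0.
pose dY x := n x * du x 0 0 + u x 0 0 * (dot (u x) (du x) / n x).
have diff x := projected_form_difference (du x) (nd1 x) (nd2 x).
have u0 x : u x != 0.
  by apply/eqP => ux0; have := nd1 x; rewrite -/(u x) ux0 !dot3 !mxE !(mulr0, addr0) ltxx.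
have cu i : continuous (fun x => u x i 0).
  by apply: (@loop_jet_continuous R _ (fun=> 1) (fun=> 1) (fun x => x));
    [exact: continuous_cstf|exact: continuous_cstf|exact: continuous_idf].
have cdu i : continuous (fun x => du x i 0).
  by apply: (@loop_jet_continuous R _ (fun=> 1) (fun=> 1) (fun x => x));
    [exact: continuous_cstf|exact: continuous_cstf|exact: continuous_idf].
have dux i x : is_derive x (1 : R) (fun y => u y i 0) (du x i 0).
  exact: is_derive_loop_coord.
have cn : continuous n by exact: continuous_enormf.
have cdX : continuous dX by rewrite /dX; continuity; [exact: cu|exact: cdu|exact: cu|exact: cdu].
have cdot := continuous_dotf cu cdu.
have cdY : continuous dY.
  rewrite /dY; continuity; [exact: cdu|exact: cu|].
  by move=> z; rewrite gt_eqF // enorm_gt0.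
have pX : primitive02 X dX.
  split=> [|x _]; first by rewrite /X; continuity; exact: cu.
  exact: (is_derive1M (dux 1 x) (dux 2%:R x)).
have pY : primitive02 Y dY.
  split=> [|x _]; first by rewrite /Y; continuity; exact: cu.
  exact: (is_derive1M (is_derive_enorm (u0 x) (fun i => dux i x)) (dux 0 x)).
have XY0 x : X x * X x + Y x * Y x != 0.
  by have [+ _] := diff x; move=> h; rewrite gt_eqF.
have turn x : [/\ X (x + 1) = - X x, Y (x + 1) = - Y x, dX (x + 1) = - dX x
    & dY (x + 1) = - dY x].
  rewrite /X /Y /dX /dY /n /u /du; have [-> ->] := loop_jet_half_turn x.
  rewrite -/(u x) -/(du x); set u' := \col_i _; set du' := \col_i _.
  have -> : enorm u' = enorm (u x) by rewrite /enorm !dot3 !mxE /=; congr Num.sqrt; ring.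
  have -> : dot u' du' = dot (u x) (du x) by rewrite !dot3 !mxE /=; ring.
  by rewrite !mxE /=; split; ring.
have [X1 Y1 _ _] := turn 0; rewrite add0r in X1 Y1.
have wP x : angular_velocity X Y dX dY (x + 1) = angular_velocity X Y dX dY x.
  by rewrite /angular_velocity; have [-> -> -> ->] := turn x; rewrite !mulrNN.
have := half_turn_winding pX pY cdX cdY XY0 X1 Y1 wP.
suff <- : loop_integral 1 1 1 - loop_integral 2%:R 1 1 =
    integral02 (angular_velocity X Y dX dY) by rewrite subr_eq0.
rewrite /loop_integral -integral02B; try exact: loop_form_continuous1.
by congr integral02; apply/funext => x; have [_ <-] := diff x.
Qed.

End TwistOfTrigLoops.

(** * Absence of a continuous section *)

Section NoFramingAlgorithm.
Variable R : realType.

(** The half turn about axis 0 changes the signs of coordinates 1 and 2. *)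
Lemma trig_loop_similar (ab : ((-1 : R) != 0) || ((1 : R) != 0))
    (ba : ((1 : R) != 0) || ((-1 : R) != 0)) :
  Defs.similar (immersed_trig_loop ab) (immersed_trig_loop ba).
Proof.
exists (\matrix_(i, j) (if i == j then (if i == 0 then 1 else -1) else 0)), 1, 0; split=> [|//|t].
- split.
    by apply/matrixP; apply: ord3P; apply: ord3P; rewrite !mxE sum3 !mxE /=; ring.
  by rewrite det3 !mxE /=; ring.
- by apply/colP; apply: ord3P; rewrite !mxE sum3 !mxE /=; ring.
Qed.

Lemma loop_class_continuous (a b : R -> R) (ab : forall s, (a s != 0) || (b s != 0)) :
  continuous a -> continuous b ->
  continuous (fun s => \pi_(spaceB R) (immersed_trig_loop (ab s))).
Proof.
move=> ca cb s.
have cl : continuous (fun s => immersed_trig_loop (ab s)).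
  by apply: continuous_comp_initial; exact: trig_loop_continuous.
exact: (continuous_comp (cl s) (@pi_continuous _ _ _)).
Qed.

(** The difference is continuous in the parameter and has zero sine. *)
Lemma twist_along_loops (sigma : spaceB R -> spaceM R) (j : 'I_3) (a b : R -> R)
    (ab : forall s, (a s != 0) || (b s != 0)) :
  continuous sigma -> (forall c, forget (sigma c) = c) ->
  continuous a -> continuous b -> (forall s, transverse j (a s) (b s)) ->
  forall s t,
    loop_integral j (a s) (b s)
      - moduli_twist (sigma (\pi_(spaceB R) (immersed_trig_loop (ab s))))
    = loop_integral j (a t) (b t)
      - moduli_twist (sigma (\pi_(spaceB R) (immersed_trig_loop (ab t)))).
Proof.
move=> csigma sigmaK ca cb nd.
pose h s := loop_integral j (a s) (b s)
  - moduli_twist (sigma (\pi_(spaceB R) (immersed_trig_loop (ab s)))).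
apply: (@continuous_sin_eq0 R h) => [|s].
  apply: continuous_addf; first exact: loop_integral_continuous.
  apply: continuous_oppf => s.
  have c1 := @loop_class_continuous a b ab ca cb.
  exact: (continuous_comp (continuous_comp (c1 s) (csigma _)) (@moduli_twist_continuous R _)).
rewrite /h -loop_integralE //.
apply: (@moduli_twist_projected R _ (immersed_trig_loop (ab s))).
- exact: sigmaK.
- exact: dot_axis.
- by move=> t; rewrite derivI_trig_loop; exact: nd.
Qed.

End NoFramingAlgorithm.

Theorem corollary4p4 (R : realType) :
  ~ exists sigma : spaceB R -> spaceM R,
      continuous sigma /\ forall b : spaceB R, forget (sigma b) = b.
Proof.
move=> [sigma [csigma sigmaK]].
have one0 : (1 : R) != 0 := oner_neq0 R.
have ab1 (s : R) : (s != 0) || ((1 : R) != 0) by rewrite one0 orbT.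
have ab2 (s : R) : ((1 : R) != 0) || (s != 0) by rewrite one0.
have nd1 (s : R) : transverse 1 s 1 by move=> x; exact: transverse_axis1.
have nd2 (s : R) : transverse 2%:R 1 s by move=> x; exact: transverse_axis2.
have c1 : continuous (fun _ : R => (1 : R)) by exact: continuous_cstf.
have cid : continuous (fun s : R => s) by exact: continuous_idf.
have := @twist_along_loops R sigma 1 (fun s => s) (fun=> 1) ab1 csigma sigmaK cid c1 nd1 1 (-1).
have := @twist_along_loops R sigma 2%:R (fun=> 1) (fun s => s) ab2 csigma sigmaK c1 cid nd2 1 (-1).
rewrite (loop_integral_mirror1 (nd1 1)) (loop_integral_mirror2 (nd2 1)).
have -> : \pi_(spaceB R) (immersed_trig_loop (ab1 (-1)))
    = \pi_(spaceB R) (immersed_trig_loop (ab2 (-1))).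
  exact/eqmodP/asboolP/trig_loop_similar.
have -> : immersed_trig_loop (ab1 1) = immersed_trig_loop (ab2 1) by apply: val_inj.
have := loop_integral_neq R; move: (moduli_twist _) (moduli_twist _) => m m' /eqP neq h2 h1.
by apply: neq; lra.
Qed.
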